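(* Let $\Omega$ be a domain in $\mathbb{C}$ and let $f\colon \Omega \to \mathbb{C}$ be a continuous, open and light map. Then $f$ is a discrete map.
   Context: A domain is a non-empty connected open set. A map $f\colon X\to Y$ between topological spaces is open if the image of each open set is open. A continuous map $f\colon X\to Y$ is light if for each $y\in Y$ the pre-image $f^{-1}(y)$ is totally disconnected (its connected components are points), and discrete if for each $y \in Y$ the pre-image $f^{-1}(y)$ is a discrete subset of $X$. *)

(* Defs.v *)
From HB Require Import structures.
From mathcomp Require Import all_boot all_order all_algebra.
From mathcomp Require Import complex.
From mathcomp Require Import all_classical all_reals.
From mathcomp Require Import topology normedtype.

Set Implicit Arguments.
Unset Strict Implicit.
Unset Printing Implicit Defensive.

Import numFieldNormedType.Exports.
Local Open Scope classical_set_scope.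
Local Open Scope complex_scope.

(* R[i]^o carries the topology of the complex modulus; these instances make it
   available on R[i] itself, as numFieldNormedType does for abstract fields. *)
HB.instance Definition _ (R : realType) := PseudoPointedMetric.copy R[i] R[i]^o.
HB.instance Definition _ (R : realType) := NormedModule.copy R[i] R[i]^o.

Section maps.
Context {X Y : topologicalType}.
Implicit Types f : X -> Y.

Definition domain (D : set X) := [/\ D !=set0, open D & connected D].

Definition open_map f := forall U : set X, open U -> open (f @` U).

Definition light_map f := forall y : Y, totally_disconnected (f @^-1` [set y]).

Definition discrete_subset (A : set X) := A `<=` isolated A.

Definition discrete_map f := forall y : Y, discrete_subset (f @^-1` [set y]).

End maps.

(* Main.v *)
(** Suppose that [x0] is not isolated in its fiber, over [y0 = 0] say. Lightness yields a
    neighbourhood [U] of [x0] over which [g = f - y0] is proper onto a small diamond [D]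
    (ball of the l1 norm) centred at [0]; by openness, over a connected open [S] in [D], each
    component of [U `&` g @^-1` S] maps onto [S], so the number of these components is finite,
    and bounded uniformly over all [S] containing a fixed open set. In contrast, the number
    of components over a diamond of radius [r] grows to infinity as [r] tends to [0].

    Let [P1] and [P2] be two opposite open quadrants of [D], each enlarged by the diamond of
    radius [r], and [O1], [O2] their preimages in [U]. For small [r] there are many pairs
    [(p_k, q_k)] of points of the fiber, all in distinct components of [O1 `&` O2], with
    [p_k] and [q_k] in the same component of [O1] and in the same component of [O2]. Then
    [(z - p_k) / (z - q_k)] has a continuous argument off [O1], and another one off [O2]; their
    difference off [O1 `|` O2] is locally constant with values in [2 pi Z]. By openness of
    [g] each bounded clopen part of the complement of [O1 `|` O2] contains a component over
    one of the two other quadrants (minus the small diamond), and there are boundedly many of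
    those. So with enough pairs an integer combination with exponents [n_k], not all zero,
    makes the two arguments agree up to a constant, and
    [\prod_k ((z - p_k) / (z - q_k)) ^ n_k] has a continuous argument off [O1 `&` O2]. But the
    component of [O1 `&` O2] containing [p_k] contains no other [p_j] or [q_j], and a winding
    number argument forces [n_k = 0] for every [k], a contradiction. *)
Require Import Defs.
From mathcomp Require Import all_boot all_order all_algebra.
From mathcomp Require Import complex.
From mathcomp Require Import all_classical all_reals.
From mathcomp Require Import topology normedtype.
From mathcomp Require Import numfun derive trigo.
From mathcomp Require Import ring lra.
Import numFieldNormedType.Exports.
Import Order.TTheory GRing.Theory Num.Theory.
Local Open Scope classical_set_scope.
Local Open Scope complex_scope.
Local Open Scope ring_scope.
Set Implicit Arguments.
Unset Strict Implicit.
Local Notation Re := complex.Re.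
Local Notation Im := complex.Im.

(** * Topology of the plane *)

Section plane_topology.
Context {R : realType}.
Implicit Types (z w p q : R[i]) (A B : set R[i]).

Lemma nbhs_complexP z A : nbhs z A <->
  exists2 e : R, 0 < e &
    forall w, `|Re w - Re z| < e -> `|Im w - Im z| < e -> A w.
Proof.
split.
  move=> /nbhs_ballP[[e i] /= e0 eA].
  (* In the partial order of [R[i]] a positive radius has zero imaginary part, so it is a real
     number. *)
  move: e0; rewrite ltcE /= => /andP[/eqP i0 e0]; subst i.
  exists (e / 2); first by rewrite divr_gt0.
  move=> w hr hi; apply: eA.
  rewrite -ball_normE /= normc_def ltcR.
  rewrite -[ltRHS]ger0_norm ?ltW// -sqrtr_sqr ltr_sqrt ?exprn_gt0//.
  case: z w hr hi => [a b] [c d] /=.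
  rewrite !ltr_norml => /andP[? ?] /andP[? ?]; nra.
case=> e e0 eA; apply/nbhs_ballP; exists e%:C; first by rewrite /= ltcR.
move=> w; rewrite -ball_normE /= => zw.
have H (x y : R) : (Num.sqrt (x ^+ 2 + y ^+ 2))%:C < e%:C -> `|x| < e /\ `|y| < e.
  rewrite ltcR => h; split; apply: le_lt_trans h; rewrite -sqrtr_sqr ler_wsqrtr//.
    by rewrite lerDl sqr_ge0.
  by rewrite lerDr sqr_ge0.
move: zw; rewrite normc_def => /H.
by case: z w eA => [a b] [c d] /= eA [? ?]; apply: eA => /=; rewrite distrC.
Qed.

Lemma continuous_Re : continuous (fun z : R[i] => Re z : R).
Proof.
move=> z P /nbhs_ballP[e /= e0 eP]; apply/nbhs_complexP.
by exists e => // w h _; apply: eP; rewrite -ball_normE /= distrC.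
Qed.

Lemma continuous_Im : continuous (fun z : R[i] => Im z : R).
Proof.
move=> z P /nbhs_ballP[e /= e0 eP]; apply/nbhs_complexP.
by exists e => // w _ h; apply: eP; rewrite -ball_normE /= distrC.
Qed.

Lemma cvg_complex (T : Type) (F : set_system T) {FF : Filter F} (x y : T -> R) a b :
  x @ F --> a -> y @ F --> b -> (fun t => x t +i* y t) @ F --> a +i* b.
Proof.
move=> xa yb P /nbhs_complexP[e e0 eP].
have hx := @cvgr_dist_lt _ _ _ _ FF x a xa e e0.
have hy := @cvgr_dist_lt _ _ _ _ FF y b yb e e0.
apply: filterS2 hx hy => t ht1 ht2 /=.
by apply: eP => /=; rewrite distrC.
Qed.

Lemma continuous_complex (T : topologicalType) (g : T -> R[i]) :
  continuous (fun t => Re (g t)) -> continuous (fun t => Im (g t)) -> continuous g.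
Proof.
move=> cr ci t; have gE s : Re (g s) +i* Im (g s) = g s by case: (g s).
rewrite /continuous_at -gE -(funext gE).
by apply: cvg_complex; [exact: cr|exact: ci].
Qed.

Lemma complex_hausdorff : hausdorff_space R[i].
Proof. exact: norm_hausdorff. Qed.

Lemma rect_compact (a b c d : R) :
  compact [set z : R[i] | (a <= Re z <= b) && (c <= Im z <= d)].
Proof.
have -> : [set z : R[i] | (a <= Re z <= b) && (c <= Im z <= d)] =
    (fun u : R * R => u.1 +i* u.2) @` (`[a, b] `*` `[c, d]).
  apply/seteqP; split => [[x y] /= /andP[xab ycd]|_ [[x y] [/= xab ycd] <-]] /=.
    by exists (x, y) => //=; rewrite !in_itv.
  by move: xab ycd; rewrite !in_itv /= => -> ->.
apply: continuous_compact; last by apply: compact_setX; exact: segment_compact.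
apply: continuous_subspaceT; apply: continuous_complex => /= u.
  exact: cvg_fst.
exact: cvg_snd.
Qed.

Lemma convex_connected A :
  (forall z w (t : R), A z -> A w -> 0 <= t <= 1 ->
    A ((Re z + t * (Re w - Re z)) +i* (Im z + t * (Im w - Im z)))) ->
  connected A.
Proof.
move=> cA; have [->|/set0P[z Az]] := eqVneq A set0; first exact: connected0.
pose g w (t : R) := (Re z + t * (Re w - Re z)) +i* (Im z + t * (Im w - Im z)).
have -> : A = \bigcup_(w in A) (g w @` `[0, 1]).
  apply/seteqP; split=> [w Aw|w [v Av [t /=]]].
    exists w => //; exists 1; first by rewrite /= in_itv /= ler01 lexx.
    by rewrite /g !mul1r; case: w Aw => a b _ /=; congr (_ +i* _); ring.
  by rewrite in_itv /= => t01 <-; apply: cA.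
apply: bigcup_connected.
  exists z => w Aw; exists 0; first by rewrite /= in_itv /= ler01 lexx.
  by rewrite /g !mul0r !addr0; case: z {Az g}.
move=> w Aw; apply: connected_continuous_connected; first exact: segment_connected.
apply: continuous_subspaceT; apply: continuous_complex => /= t.
  by apply: cvgD; [exact: cvg_cst | apply: cvgM; [exact: cvg_id | exact: cvg_cst]].
by apply: cvgD; [exact: cvg_cst | apply: cvgM; [exact: cvg_id | exact: cvg_cst]].
Qed.

Lemma convex_gt0 (u v t : R) : 0 < u -> 0 < v -> 0 <= t <= 1 ->
  0 < u + t * (v - u).
Proof.
move=> u0 v0 /andP[t0 t1]; rewrite (_ : _ + _ = (1 - t) * u + t * v); last by ring.
have [->|tn0] := eqVneq t 0; first by rewrite subr0 mul1r mul0r addr0.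
apply: ltr_wpDl; first by apply: mulr_ge0; [rewrite subr_ge0 | exact: ltW].
by rewrite mulr_gt0// lt_neqAle eq_sym tn0.
Qed.

(** Local connectedness: a small box around a point of [A] is convex and lies in [A]. *)
Lemma component_open A z : open A -> open (connected_component A z).
Proof.
move=> oA; rewrite openE => w Azw.
have Aw := connected_component_sub Azw.
have /nbhs_complexP[e e0 eA] : nbhs w A by exact: open_nbhs_nbhs.
pose B := [set v | `|Re v - Re w| < e /\ `|Im v - Im w| < e].
apply/nbhs_complexP; exists e => // v vr vi.
apply: connected_component_trans Azw _; exists B => //; split.
- by split; rewrite subrr normr0.
- by move=> u [ur ui]; exact: eA.
- apply: convex_connected => a b t [ar ai] [br bi] t01.
  have K (x y c : R) : `|x - c| < e -> `|y - c| < e -> `|x + t * (y - x) - c| < e.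
    rewrite !ltr_norml => /andP[x1 x2] /andP[y1 y2].
    have h1 : 0 < (x - c + e) + t * ((y - c + e) - (x - c + e)).
      by apply: convex_gt0 => //; lra.
    have h2 : 0 < (e - x + c) + t * ((e - y + c) - (e - x + c)).
      by apply: convex_gt0 => //; lra.
    by apply/andP; split; lra.
  by split; apply: K.
Qed.

End plane_topology.

(** * Connected sets and decreasing families of compact sets *)

Section general_topology.
Implicit Types T U : topologicalType.

(** Induction along a connected set: [P] is locally constant on [X], so the points where it holds
    form a clopen part of [X]. *)
Lemma connected_ind T (X : set T) (P : T -> Prop) x :
    connected X -> X x -> P x ->
    (forall y, X y -> \forall z \near within X (nbhs y), P y <-> P z) ->
  forall y, X y -> P y.
Proof.
move=> cX Xx Px nP y Xy.
suff XP : X `&` P = X by have [] : (X `&` P) y by rewrite XP.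
apply: cX; first by exists x.
  exists (interior [set z | X z -> P z]); first exact: open_interior.
  apply/seteqP; split => z [Xz] => [Pz|/nbhs_singleton/=]; last by move/(_ Xz).
  split=> //; have := nP z Xz; rewrite near_withinE.
  by apply: filterS => t h /h [] h1 _; exact: h1.
exists (~` interior [set z | X z -> ~ P z]); first exact/open_closedC/open_interior.
apply/seteqP; split => z [Xz] => [Pz|nPz]; split=> //.
  by move/nbhs_singleton => /(_ Xz); apply.
apply: contrapT => Pz; apply: nPz.
have := nP z Xz; rewrite near_withinE.
by apply: filterS => t h /h [] _ h1 /h1.
Qed.

Lemma closed_within_preimage T U (X : set T) (w : T -> U) (C : set U) :
  closed X -> {within X, continuous w} -> closed C -> closed (X `&` w @^-1` C).
Proof.
move=> clX /continuous_closedP/(_ C) wC /wC/closed_subspaceP[V clV VX].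
by rewrite setIC -VX; exact: closedI.
Qed.

(** Otherwise the sets [F r] minus [O] generate a proper filter on [M]. Its cluster point lies in
    every closed [F r], hence in the open set [O], which the filter avoids. *)
Lemma decreasing_compact_shrink (R : realType) T (M : set T) (F : R -> set T)
    (O : set T) :
    compact M -> open O ->
    (forall r, 0 < r -> closed (F r) /\ F r `<=` M) ->
    (forall r s, 0 < r <= s -> F r `<=` F s) ->
    (forall z, (forall r, 0 < r -> F r z) -> O z) ->
  exists2 r, 0 < r & F r `<=` O.
Proof.
move=> cM oO clF monF FO; apply: contrapT => nF.
pose G : set_system T := [set P | exists2 r, 0 < r & F r `\` O `<=` P].
have FG : ProperFilter G.
  split.
    move=> [r r0 Fr]; apply: nF; exists r => // z Fz.
    by apply: contrapT => Oz; exact: (Fr z).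
  split.
  - by exists 1.
  - move=> P Q [r r0 rP] [s s0 sQ]; exists (Num.min r s).
      by rewrite lt_min r0.
    move=> z [Fz Oz]; split; [apply: rP | apply: sQ]; split => //.
      by apply: monF Fz; rewrite lt_min r0 s0 ge_min lexx.
    by apply: monF Fz; rewrite lt_min r0 s0 ge_min lexx orbT.
  - by move=> P Q PQ [r r0 rP]; exists r => //; exact: subset_trans PQ.
have GM : G M by exists 1 => // z [Fz _]; have [_] := clF 1 ltr01; apply.
have [z [Mz clz]] := cM G FG GM.
have Oz : O z.
  apply: FO => r r0; have [clFr _] := clF r r0; apply: clFr => W Wz.
  have GF : G (F r) by exists r => // w [].
  by have := clz _ _ GF Wz.
have [w [[_ nOw] Ow]] : ((F 1 `\` O) `&` O) !=set0.
  by apply: clz; [exists 1 | exact: open_nbhs_nbhs].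
exact: nOw.
Qed.

(** Normality puts the two halves of a separation of the intersection into disjoint open sets. By
    the shrinking lemma some [F r] lies in their union, and it meets both. *)
Lemma decreasing_compact_connected (R : realType) T (M : set T) (F : R -> set T) :
    normal_space T -> compact M ->
    (forall r, 0 < r -> closed (F r) /\ F r `<=` M) ->
    (forall r, 0 < r -> connected (F r)) ->
    (forall r s, 0 < r <= s -> F r `<=` F s) ->
  connected (\bigcap_(r in [set r | 0 < r]) F r).
Proof.
move=> nT cM clF cF monF; apply/connectedP => E [E0 EU [sE1 sE2]].
set C := \bigcap_(r in _) F r in EU.
have clC : closed C by apply: closed_bigI => r r0; have [] := clF r r0.
have clE b : closed (E b).
  move=> z Ez; have : C z.
    apply: clC; apply: closureS Ez; rewrite EU; case: b => w Ew; by [right|left].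
  rewrite EU; case: b Ez => Ez [] // Ez'; exfalso.
    by move/seteqP: sE2 => [/(_ z)+ _]; apply; split.
  by move/seteqP: sE1 => [/(_ z)+ _]; apply; split.
have E01 : E false `&` E true = set0.
  by rewrite -subset0 -sE1; apply: setSI; exact: subset_closure.
have [V0 [V1 [oV0 oV1 EV0 EV1 V01]]] :=
  (@normal_openP R T).1 nT _ _ (clE false) (clE true) E01.
have [r r0 FV] : exists2 r : R, 0 < r & F r `<=` V0 `|` V1.
  apply: (decreasing_compact_shrink cM) => //; first exact: openU.
  by move=> z Fz; have : C z by []; rewrite EU => -[/EV0|/EV1]; [left|right].
have sV : separated V0 V1.
  split; apply/seteqP; split => // z [].
    by move=> clz V1z; have := clz V1 (open_nbhs_nbhs (conj oV1 V1z)); rewrite V01 => -[].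
  by move=> V0z clz; have := clz V0 (open_nbhs_nbhs (conj oV0 V0z)); rewrite setIC V01 => -[].
have [x0 Ex0] := E0 false; have [x1 Ex1] := E0 true.
have EF b : E b `<=` F r.
  move=> z Ez; have : C z by rewrite EU; case: b Ez; [right|left].
  by apply.
have [FV0|FV1] := connected_subset sV FV (cF r r0).
  have : (V0 `&` V1) x1 by split; [exact/FV0/(EF _ _ Ex1) | exact: EV1].
  by rewrite V01.
have : (V0 `&` V1) x0 by split; [exact: EV0 | exact/FV1/(EF _ _ Ex0)].
by rewrite V01.
Qed.

(** As [r] tends to 0 the components of [p] decrease to a connected set on which [h <= 0], that is,
    to [p] alone. So from some [r] on they avoid [W]. *)
Lemma component_shrink (R : realType) T (M W : set T) (h : T -> R) p :
    hausdorff_space T -> normal_space T -> compact M -> {within M, continuous h} ->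
    totally_disconnected (M `&` [set z | h z <= 0]) ->
    M p -> h p <= 0 -> closed W -> ~ W p ->
  exists2 r, 0 < r &
    connected_component (M `&` [set z | h z <= r]) p `&` W = set0.
Proof.
move=> hT nT cM ch td Mp hp clW Wp.
have clM : closed M := compact_closed hT cM.
pose F r := connected_component (M `&` [set z | h z <= r]) p.
have clF r : 0 < r -> closed (F r) /\ F r `<=` M.
  move=> r0; split; last by move=> z /connected_component_sub[].
  by apply: component_closed; exact: (closed_within_preimage clM ch (@closed_le _ r)).
have monF r s : 0 < r <= s -> F r `<=` F s.
  move=> /andP[_ rs] z [C [Cp CM cC] Cz]; exists C => //; split=> //.
  by move=> w /CM[Mw hw]; split=> //; exact: le_trans rs.
have Fp r : 0 < r -> F r p.
  by move=> r0; apply: connected_component_refl; split => //; exact/(le_trans hp)/ltW.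
have cC := decreasing_compact_connected nT cM clF (fun r _ => @component_connected _ _ _) monF.
have [r r0 FW] : exists2 r : R, 0 < r & F r `<=` ~` W.
  apply: (decreasing_compact_shrink cM) => //; first exact: closed_openC.
  move=> z Fz Wz; apply: Wp.
  suff : connected_component (M `&` [set z | h z <= 0]) p z.
    by rewrite (td p (conj Mp hp))=> <-.
  exists (\bigcap_(r in [set r : R | 0 < r]) F r) => //; split => //.
  move=> w Fw; split; first by have [_] := clF 1 ltr01; apply; exact: (Fw 1 ltr01).
  rewrite /= leNgt; apply/negP => hw.
  have : F (h w / 2) w by apply: Fw; rewrite /= divr_gt0.
  by move=> /connected_component_sub[_ /=]; lra.
by exists r => //; apply/seteqP; split => // z [/FW].
Qed.

End general_topology.

(** * Normality of the plane and extension from compact sets *)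

Section plane_normal.
Context {R : realType}.

Let toC (u : R * R) : R[i] := u.1 +i* u.2.
Let ofC (z : R[i]) : R * R := (Re z, Im z).

Let continuous_toC : continuous toC.
Proof. by apply: continuous_complex => u; [exact: cvg_fst | exact: cvg_snd]. Qed.

Let continuous_ofC : continuous ofC.
Proof. by move=> z; exact: (cvg_pair (@continuous_Re R z) (@continuous_Im R z)). Qed.

(** The balls of [R[i]] have radii in [R[i]]; normality is carried over from the homeomorphic space
    [R * R], whose balls have radii in [R]. *)
Lemma complex_normal : normal_space R[i].
Proof.
apply/(@normal_openP R) => A B clA clB AB.
have ofCK z : toC (ofC z) = z by case: z.
have [||| V0 [V1 [oV0 oV1 AV BV V01]]] :=
  (@normal_openP R _).1 (@pseudometric_normal R (R * R)%type) (toC @^-1` A) (toC @^-1` B).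
- by move/continuous_closedP: continuous_toC; apply.
- by move/continuous_closedP: continuous_toC; apply.
- by apply/seteqP; split => // u; rewrite -[_ u]/((A `&` B) (toC u)) AB.
exists (ofC @^-1` V0), (ofC @^-1` V1); split.
- by move/continuousP: continuous_ofC; apply.
- by move/continuousP: continuous_ofC; apply.
- by move=> z Az; apply: AV; rewrite /= ofCK.
- by move=> z Bz; apply: BV; rewrite /= ofCK.
- by apply/seteqP; split => // z; rewrite -[_ z]/((V0 `&` V1) (ofC z)) V01.
Qed.

(** Tietze extension; compactness of [K] supplies the bound on [a]. *)
Lemma compact_continuous_extension (K : set R[i]) (a : R[i] -> R) :
  compact K -> {within K, continuous a} ->
  exists2 b : R[i] -> R, continuous b & forall z, K z -> a z = b z.
Proof.
move=> cK ca; have clK := compact_closed complex_hausdorff cK.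
have [N [Nr aN]] := compact_bounded (continuous_compact ca cK).
have M0 : 0 < `|N| + 1 by rewrite ltr_wpDl.
have [|b [ab cb _]] := continuous_bounded_extension complex_normal clK M0 ca.
  move=> z Kz; apply: (aN (`|N| + 1)); last by exists z.
  by rewrite ltr_pwDr// ler_norm.
by exists b => // z Kz; apply: ab; rewrite inE.
Qed.

End plane_normal.

(** * Continuous arguments and winding numbers *)

Section angles.
Context {R : realType}.
Implicit Types (a b t : R) (z w p q : R[i]) (K O V : set R[i]).
Implicit Types (g h : R[i] -> R[i]).

Definition cis a : R[i] := cos a +i* sin a.

Lemma cis0 : cis 0 = 1.
Proof. by rewrite /cis cos0 sin0. Qed.

Lemma cisD a b : cis (a + b) = cis a * cis b.
Proof. by rewrite /cis cosD sinD; congr (_ +i* _); rewrite addrC. Qed.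

Lemma cis_neq0 a : cis a != 0.
Proof.
apply/negP => /eqP/(congr1 (fun z : R[i] => Re z ^+ 2 + Im z ^+ 2)) /=.
by rewrite cos2Dsin2 expr0n addr0; apply/eqP; exact: oner_neq0.
Qed.

Lemma norm_cis a : `|cis a| = 1.
Proof. by rewrite normc_def /= cos2Dsin2 sqrtr1. Qed.

Lemma cisN a : cis (- a) = (cis a)^-1.
Proof. by apply: (mulfI (cis_neq0 a)); rewrite -cisD subrr cis0 divff ?cis_neq0. Qed.

Lemma cisMn a n : cis (a *+ n) = cis a ^+ n.
Proof. by elim: n => [|n IH]; rewrite ?mulr0n ?cis0 ?expr0// mulrS exprS cisD IH. Qed.

Lemma cisMz a (n : int) : cis (a *~ n) = cis a ^ n.
Proof.
case: n => n; first by rewrite -pmulrn cisMn.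
by rewrite NegzE mulrNz -pmulrn cisN cisMn exprnN.
Qed.

Lemma cis_sum (I : Type) (r : seq I) (f : I -> R) :
  cis (\sum_(i <- r) f i) = \prod_(i <- r) cis (f i).
Proof. by apply: (big_morph cis cisD cis0). Qed.

Lemma cis2pi : cis (pi *+ 2) = 1.
Proof. by rewrite /cis cos2pi sin2pi. Qed.

(** For [y] the modulus of the difference, [cos y = 1] forces [sin (y / 2) = 0], whereas this sine
    is positive for [0 < y < 2 pi]. *)
Lemma cis_inj a b : cis a = cis b -> `|a - b| < pi *+ 2 -> a = b.
Proof.
move=> ab abpi; have {ab} : cis (a - b) = 1 by rewrite cisD cisN ab divff ?cis_neq0.
case => c1 _; apply/eqP; rewrite -subr_eq0; move: (a - b) abpi c1 => x xpi c1.
rewrite -normr_eq0; move: xpi; rewrite -cos_norm in c1.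
move: `|x| (normr_ge0 x) c1 => y y0 c1 ypi.
apply: contrapT => /negP yn0.
have s0 : 0 < sin (y / 2).
  have yp : 0 < y by rewrite lt_def yn0.
  by apply: sin_gt0_pi; apply/andP; split; [|move: ypi; rewrite mulr2n]; lra.
move: c1; rewrite (_ : y = y / 2 *+ 2); last by rewrite mulr2n; lra.
rewrite cos_mulr2n cos2sin2 => h.
have : sin (y / 2) ^+ 2 = 0 by move: h; rewrite mulr2n; lra.
by move/eqP; rewrite expf_eq0 /= gt_eqF.
Qed.

Lemma continuous_cis : continuous cis.
Proof. by move=> t; apply: cvg_complex; [exact: continuous_cos | exact: continuous_sin]. Qed.

Lemma cis_asin z : `|z| = 1 -> 0 < Re z -> cis (asin (Im z)) = z.
Proof.
case: z => x y; rewrite normc_def /= => -[h x0].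
have xy : x ^+ 2 + y ^+ 2 = 1.
  by rewrite -[LHS]sqr_sqrtr ?h ?expr1n// addr_ge0 ?sqr_ge0.
have y1 : -1 <= y <= 1 by apply/andP; split; nra.
rewrite /cis asinK ?in_itv//= cos_asin//; congr (_ +i* _).
by rewrite -xy addrK sqrtr_sqr gtr0_norm.
Qed.

Lemma Re_realM (x : R) z : Re (x%:C * z) = x * Re z.
Proof. by case: z => a b /=; rewrite mul0r subr0. Qed.

Lemma Re_gt0_near1 z : `|1 - z| < 1 -> 0 < Re z.
Proof.
move=> z1; have := le_lt_trans (normc_ge_Re (1 - z)) z1.
by rewrite ltcR raddfB /= ltr_norml => /andP[_]; lra.
Qed.

(** The unit vector from [p] towards [z]; at [z = p] its value is 0. *)
Definition dir p z := (z - p) / `|z - p|.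

Lemma norm_dir p z : z != p -> `|dir p z| = 1.
Proof.
by move=> zp; rewrite normrM normfV normr_id divff// normr_eq0 subr_eq0.
Qed.

Lemma dir_neq0 p z : z != p -> dir p z != 0.
Proof. by move=> zp; rewrite -normr_eq0 norm_dir ?oner_neq0. Qed.

Lemma cvg_subr p z : (w - p) @[w --> z] --> z - p.
Proof.
have cz : w @[w --> z] --> z by move=> P.
exact: (cvgB cz (@cvg_cst _ p _ (nbhs z) _)).
Qed.

Lemma continuous_dir p z : z != p -> {for z, continuous (dir p)}.
Proof.
move=> zp; have zp0 : `|z - p| != 0 by rewrite normr_eq0 subr_eq0.
exact: (cvgM (@cvg_subr p z) (cvgV zp0 (cvg_norm (@cvg_subr p z)))).
Qed.

(** A continuous lift of [g] on [K] through the covering [cis] of the unit circle. *)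
Definition has_arg K (g : R[i] -> R[i]) :=
  exists2 a : R[i] -> R, {within K, continuous a} & forall z, K z -> g z = cis (a z).

Lemma has_arg_eq K g h : (forall z, K z -> g z = h z) -> has_arg K g -> has_arg K h.
Proof. by move=> gh [a ca ga]; exists a => // z Kz; rewrite -gh// ga. Qed.

Lemma has_arg1 K : has_arg K (fun=> 1).
Proof.
by exists (fun=> 0); [exact/continuous_subspaceT/cst_continuous | rewrite cis0].
Qed.

Lemma has_argM K g h : has_arg K g -> has_arg K h -> has_arg K (fun z => g z * h z).
Proof.
move=> [a ca ga] [b cb hb]; exists (fun z => a z + b z).
  by move=> z; apply: cvgD; [exact: ca | exact: cb].
by move=> z Kz; rewrite cisD ga ?hb.
Qed.

Lemma has_argV K g : has_arg K g -> has_arg K (fun z => (g z)^-1).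
Proof.
move=> [a ca ga]; exists (fun z => - a z).
  by move=> z; apply: cvgN; exact: ca.
by move=> z Kz; rewrite cisN ga.
Qed.

(** The values of [g] lie in the right half plane, where the arcsine of the imaginary part of the
    normalized value is an argument. *)
Lemma has_arg_near1 K g : {within K, continuous g} ->
  (forall z, K z -> `|1 - g z| < 1) -> has_arg K (fun z => g z / `|g z|).
Proof.
move=> cg g1.
have g0 z : K z -> 0 < Re (g z) by move=> /g1; exact: Re_gt0_near1.
have gn0 z : K z -> g z != 0.
  by move=> /g0; apply: contraTneq => ->; rewrite ltxx.
have u1 z : K z -> `|g z / `|g z| | = 1.
  by move=> Kz; rewrite normrM normfV normr_id divff// normr_eq0 gn0.
have u0 z : K z -> 0 < Re (g z / `|g z|).
  move=> Kz; have := gn0 z Kz; rewrite -normr_eq0 normc_def => h.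
  have s0 : 0 < Num.sqrt (Re (g z) ^+ 2 + Im (g z) ^+ 2).
    by rewrite lt_def sqrtr_ge0 andbT -(inj_eq (@complexI R)).
  by rewrite -fmorphV mulrC Re_realM mulr_gt0 ?invr_gt0 ?g0.
have cgn : {within K, continuous (fun z => g z / `|g z|)}.
  apply/subspace_continuousP => z Kz.
  have gz := (subspace_continuousP _ _).1 cg z Kz.
  have h : `|g z| != 0 by rewrite normr_eq0 gn0.
  exact: (cvgM gz (cvgV h (cvg_norm gz))).
exists (fun z => asin (Im (g z / `|g z|))).
  apply/subspace_continuousP => z Kz.
  have gz := (subspace_continuousP _ _).1 cgn z Kz.
  have gi := cvg_comp _ _ gz (@continuous_Im R _).
  suff ca : {for Im (g z / `|g z|), continuous (@asin R)} by exact: (cvg_comp _ _ gi ca).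
  apply: continuous_asin; move: (u1 z Kz) (u0 z Kz).
  case: (g z / _) => x y; rewrite normc_def /= => -[e x0].
  have xy : x ^+ 2 + y ^+ 2 = 1.
    by rewrite -[LHS]sqr_sqrtr ?e ?expr1n// addr_ge0 ?sqr_ge0.
  by apply/andP; split; nra.
by move=> z Kz; rewrite cis_asin ?u1 ?u0.
Qed.

(** The quotient [(z - q) / (z - p)] differs from 1 by [(q - p) / (z - p)], of modulus less than 1
    on [K]. *)
Lemma has_arg_dir_near K p q (e : R) : 0 < e ->
  (forall z, K z -> e%:C <= `|z - p|) -> `|q - p| < e%:C ->
  has_arg K (fun z => dir q z / dir p z).
Proof.
move=> e0 Ke qp.
have Kp z : K z -> z - p != 0.
  move=> /Ke; apply: contraTneq => ->; rewrite normr0 lecR -ltNge//.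
have Kg z : K z -> 1 - (z - q) / (z - p) = (q - p) / (z - p).
  move=> Kz; rewrite -[X in X - _](divff (Kp z Kz)) -mulrBl; congr (_ / _); ring.
have g1 z : K z -> `|1 - (z - q) / (z - p)| < 1.
  move=> Kz; rewrite Kg// normrM normfV ltr_pdivrMr ?normr_gt0 ?Kp// mul1r.
  exact: lt_le_trans qp (Ke z Kz).
apply: has_arg_eq (has_arg_near1 _ g1); last first.
  apply/subspace_continuousP => z Kz.
  have cz r : (w - r) @[w --> within K (nbhs z)] --> z - r.
    exact: cvg_within_filter (@cvg_subr r z).
  exact: (cvgM (cz q) (cvgV (Kp z Kz) (cz p))).
move=> z Kz; rewrite /dir.
have zp : `|z - p| != 0 by rewrite normr_eq0 Kp.
rewrite normrM normfV.
have [->|zq] := eqVneq (z - q) 0; first by rewrite normr0 !mul0r.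
have zq0 : `|z - q| != 0 by rewrite normr_eq0.
move: (Kp z Kz); move: `|z - p| `|z - q| zp zq0 => x y x0 y0 zp0.
by field; rewrite x0 zp0 y0.
Qed.

(** By the preceding lemma, moving [q] slightly inside [O] does not affect the existence of an
    argument; connectedness carries it from the trivial case [q = p] to the whole component. *)
Lemma has_arg_dir_component K O p q : open O -> O `&` K = set0 ->
  connected_component O p q -> has_arg K (fun z => dir q z / dir p z).
Proof.
move=> oO OK pq; have Op := connected_component_sub (connected_component_sym pq).
have KO z : K z -> O z -> False.
  by move=> Kz Oz; move/seteqP: OK => [/(_ z)+ _]; apply.
have dK p' z : O p' -> K z -> dir p' z != 0.
  move=> Op' Kz; apply: dir_neq0; apply/negP => /eqP zp; rewrite -zp in Op'.
  exact: KO Op'.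
apply: (connected_ind (P := fun q => has_arg K (fun z => dir q z / dir p z))
  (@component_connected _ O p)) pq.
- exact: connected_component_refl.
- by apply: has_arg_eq (has_arg1 K) => z Kz; rewrite divff ?dK.
move=> y py; have Oy := connected_component_sub py.
have /nbhs_ballP[[e i] /= + eO] : nbhs y O by exact: open_nbhs_nbhs.
rewrite ltcE /= => /andP[/eqP i0 e0]; subst i.
have Ke z : K z -> e%:C <= `|z - y|.
  move=> Kz; rewrite real_leNgt ?normr_real//; last by rewrite gtr0_real ?ltcR.
  apply/negP => zy; apply: (KO z Kz); apply: eO.
  by rewrite -ball_normE /= distrC.
have By : nbhs y (ball y e%:C) by apply: nbhsx_ballx; rewrite ltcR.
rewrite near_withinE; apply: filterS2 (open_nbhs_nbhs (conj oO Oy)) By => q' Oq' yq' _.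
have qy : `|q' - y| < e%:C by move: yq'; rewrite -ball_normE /= distrC.
have hq := has_arg_dir_near e0 Ke qy.
split => h.
  apply: has_arg_eq (has_argM hq h) => z Kz.
  by field; rewrite !dK.
apply: has_arg_eq (has_argM (has_argV hq) h) => z Kz.
by field; rewrite !dK.
Qed.

End angles.

(** * Arguments on compact sets and winding along circles *)

Section winding.
Context {R : realType}.
Implicit Types (a b t r : R) (z w p q : R[i]) (K O V : set R[i]).
Implicit Types (g h : R[i] -> R[i]).

Lemma continuous_real_complex : continuous (fun t : R => t%:C).
Proof.
by move=> t; apply: cvg_complex; [move=> P | exact: (@cvg_cst _ 0 _ (nbhs t) _)].
Qed.

(* The radial homotopy [z |-> g (p + t (z - p))] joins [g] to a constant. *)
Lemma has_arg_compact K g p : compact K -> continuous g -> (forall z, `|g z| = 1) ->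
  has_arg K (fun z => g z / g p).
Proof.
move=> cK cg g1.
have g0 z : g z != 0 by rewrite -normr_eq0 g1 oner_neq0.
pose G t z := g (p + t%:C * (z - p)).
suff /(_ 1) : forall t : R, has_arg K (fun z => G t z / g p).
  by apply: has_arg_eq => z _; rewrite /G mul1r addrC subrK.
have cR : connected [set: R] by apply/connected_intervalP => x y _ _ z _.
have cG u : {for u, continuous (fun u : R[i] * R => G u.2 u.1)}.
  apply: (cvg_comp (fun u : R[i] * R => p + u.2%:C * (u.1 - p)) g _ (cg _)).
  have h1 : v.2%:C @[v --> u] --> u.2%:C.
    have hs : v.2 @[v --> u] --> u.2 by exact: cvg_snd.
    exact: (cvg_comp _ _ hs (@continuous_real_complex u.2)).
  have h2 : (v.1 - p) @[v --> u] --> u.1 - p.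
    have hs : v.1 @[v --> u] --> u.1 by exact: cvg_fst.
    exact: (cvg_comp _ _ hs (@cvg_subr _ p u.1)).
  exact: (cvgD (@cvg_cst _ p _ (nbhs u) _) (cvgM h1 h2)).
move=> t; apply: (connected_ind (P := fun t => has_arg K (fun z => G t z / g p)) (x := 0) cR) => //.
  apply: has_arg_eq (has_arg1 K) => z Kz.
  by rewrite /G mul0r addr0 divff.
move=> s _; rewrite near_withinE.
(* Compactness of [K] makes the closeness of [G t] to [G s] uniform, so that [G t / G s] stays
   within 1 of the constant 1. *)
have GK : \forall t \near s, K `<=` [set z | `|G t z - G s z| < 1].
  apply: ((compact_near_coveringP K).1 cK _ (nbhs s) (fun t z => `|G t z - G s z| < 1)).
  move=> z Kz.
  have cGs : {for z, continuous (G s)}.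
    have h : (w, s) @[w --> z] --> (z, s).
      have cz : w @[w --> z] --> z by move=> P.
      exact: (cvg_pair cz (@cvg_cst _ s _ (nbhs z) _)).
    exact: (cvg_comp _ _ h (cG (z, s))).
  have B : nbhs (G s z) (ball (G s z) 2^-1) by apply: nbhsx_ballx; rewrite invr_gt0.
  have k1 (P : set R[i]) : nbhs (G s z) P ->
    nbhs (z, s) (fun v : R[i] * R => P (G v.2 v.1)) by move=> /(cG (z, s)).
  have k2 (P : set R[i]) : nbhs (G s z) P -> nbhs (z, s) (fun v : R[i] * R => P (G s v.1)).
    have hs : v.1 @[v --> (z, s)] --> z by exact: cvg_fst.
    by move=> /cGs /hs.
  have h1 := k1 _ B; have h2 := k2 _ B.
  have h3 : nbhs (z, s) [set v : R[i] * R | `|G v.2 v.1 - G s v.1| < 1].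
    apply: filterS2 h1 h2 => v; rewrite /= -ball_normE /= => b1 b2.
    rewrite [X in _ < X](splitr 1) div1r -[_ - _](subrKA (G s z)).
    by apply: le_lt_trans (ler_normD _ _) _; rewrite ltrD// distrC.
  exact: h3.
apply: filterS GK => u Ku _.
have h : has_arg K (fun z => G u z / G s z).
  apply: (has_arg_eq (g := fun z => (G u z / G s z) / `|G u z / G s z|)).
    by move=> z Kz; rewrite normrM normfV !g1 invr1 mulr1 divr1.
  apply: has_arg_near1.
    have cGt v : continuous (G v).
      move=> z; have h4 : (w, v) @[w --> z] --> (z, v).
        have cz : w @[w --> z] --> z by move=> P.
        exact: (cvg_pair cz (@cvg_cst _ v _ (nbhs z) _)).
      exact: (cvg_comp _ _ h4 (cG (z, v))).
    apply: continuous_subspaceT => z.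
    exact: (cvgM (cGt u z) (cvgV (g0 _) (cGt s z))).
  move=> z Kz; have := Ku z Kz; rewrite /= distrC.
  have -> : 1 - G u z / G s z = (G s z - G u z) / G s z by rewrite mulrBl divff //; exact: g0.
  by rewrite normrM normfV [`|G s z|]g1 invr1 mulr1.
split => h'.
  by apply: has_arg_eq (has_argM h h') => z Kz; field; rewrite !g0.
by apply: has_arg_eq (has_argM (has_argV h) h') => z Kz; field; rewrite !g0.
Qed.

Lemma dir_circle p r t : 0 < r -> dir p (p + r%:C * cis t) = cis t.
Proof.
move=> r0; have rC : r%:C != 0 by rewrite eq_complex /= negb_and gt_eqF.
rewrite /dir addrC addKr normrM norm_cis mulr1 ger0_norm; last by rewrite lecR ltW.
by rewrite mulrAC divff// mul1r.
Qed.

(** On the circle [dir p] is [cis t], so [a] minus [n t] is continuous in [t] with constant [cis],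
    hence constant. Since the circle closes up, comparing [t = 0] with [t = 2 pi] gives
    [2 pi n = 0]. *)
Lemma dir_exp_arg p r (n : int) c (a : R[i] -> R) K : 0 < r -> c != 0 ->
    (forall t, K (p + r%:C * cis t)) -> {within K, continuous a} ->
    (forall t, dir p (p + r%:C * cis t) ^ n = c * cis (a (p + r%:C * cis t))) ->
  n = 0.
Proof.
move=> r0 c0 Kt ca ha; pose gam t := p + r%:C * cis t.
have cgam : continuous gam.
  move=> t; have h : (r%:C * cis s) @[s --> t] --> r%:C * cis t.
    exact: (cvgM (@cvg_cst _ r%:C _ (nbhs t) _) (@continuous_cis R t)).
  exact: (cvgD (@cvg_cst _ p _ (nbhs t) _) h).
pose b t := a (gam t) - t *~ n.
have cb : continuous b.
  move=> t; have h1 : a (gam s) @[s --> t] --> a (gam t).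
    have /subspace_continuousP/(_ (gam t) (Kt t)) h := ca.
    move=> P /h aP; have {}aP : nbhs (gam t) (fun z => K z -> P (a z)) := aP.
    have : nbhs t (fun s => K (gam s) -> P (a (gam s))) := cgam t _ aP.
    by apply: filterS => s; apply; exact: Kt.
  have h2 : (s * n%:~R) @[s --> t] --> t * n%:~R by exact: mulrr_continuous.
  have bE : b = (fun s => a (gam s) - s * n%:~R).
    by apply/funext => s; rewrite /b mulrzr.
  by rewrite bE; exact: (cvgB h1 h2).
have bE t : cis (b t) = c^-1.
  apply: (mulfI c0); rewrite divff// /b cisD cisN cisMz mulrA -ha dir_circle//.
  by rewrite divff// expfz_neq0// cis_neq0.
have pi2 : 0 < pi *+ 2 :> R by rewrite pmulrn_lgt0 ?pi_gt0.
have cR : connected [set: R] by apply/connected_intervalP => x y _ _ z _.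
have bc t : b t = b 0.
  apply: (connected_ind (P := fun t => b t = b 0) (x := 0) cR) => // s _.
  have hb : nbhs s (fun u => `|b s - b u| < pi *+ 2).
    exact: (@cvgr_dist_lt _ _ _ _ _ b (b s) (cb s) _ pi2).
  rewrite near_withinE; apply: filterS hb => u su _.
  by rewrite (cis_inj (a := b s) (b := b u)) ?bE.
have := bc (pi *+ 2); rewrite /b /gam cis2pi cis0 mul0rz subr0 => /eqP.
rewrite -subr_eq0 addrAC subrr add0r oppr_eq0 -mulrzr mulf_eq0 gt_eqF//= intr_eq0.
by move/eqP.
Qed.

End winding.

(** * Vanishing of an exponent by a winding number argument *)

Section exponent_zero.
Context {R : realType}.
Implicit Types (a b t r : R) (z w p q : R[i]) (K O V M : set R[i]).
Implicit Types (g h : R[i] -> R[i]).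

Lemma continuous_exprz g z (n : int) : g z != 0 -> {for z, continuous g} ->
  {for z, continuous (fun w => g w ^ n)}.
Proof.
move=> gz cg.
have cX (m : nat) : {for z, continuous (fun w => g w ^+ m)}.
  elim: m => [|m IH]; first by exact: (@cvg_cst _ (1 : R[i]) _ (nbhs z) _).
  rewrite (_ : (fun w => _) = (fun w => g w * g w ^+ m)); first exact: (cvgM cg IH).
  by apply/funext => w; rewrite exprS.
case: n => m; first exact: cX.
have h : g z ^+ m.+1 != 0 by rewrite expf_neq0.
have e : (fun w => g w ^ Negz m) = (fun w => (g w ^+ m.+1)^-1).
  by apply/funext => w; rewrite NegzE -exprnN.
by rewrite e; exact: (cvgV h (cX m.+1)).
Qed.

Lemma norm_exprz1 z (n : int) : `|z| = 1 -> `|z ^ n| = 1.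
Proof.
by move=> z1; case: n => m; rewrite ?NegzE -?exprnN ?normfV normrX z1 expr1n ?invr1.
Qed.

Definition sqdist p z : R := (Re z - Re p) ^+ 2 + (Im z - Im p) ^+ 2.

Lemma continuous_sqdist p : continuous (sqdist p).
Proof.
move=> z; have hr : (Re w - Re p) @[w --> z] --> Re z - Re p.
  exact: (cvgB (@continuous_Re R z) (@cvg_cst _ (Re p) _ (nbhs z) _)).
have hi : (Im w - Im p) @[w --> z] --> Im z - Im p.
  exact: (cvgB (@continuous_Im R z) (@cvg_cst _ (Im p) _ (nbhs z) _)).
have := cvgD (cvgM hr hr) (cvgM hi hi); exact.
Qed.

Lemma sqdist_cis p r a : sqdist p (p + r%:C * cis a) = r ^+ 2.
Proof.
rewrite /sqdist !raddfD /= !(mul0r, subr0, addr0) ![_ + _ - _]addrAC !subrr !add0r.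
by rewrite !exprMn -mulrDr cos2Dsin2 mulr1.
Qed.

Lemma circle_avoids_compact M p : compact M ->
  exists2 r : R, 0 < r & forall t, ~ M (p + r%:C * cis t).
Proof.
move=> cM; have [->|/set0P M0] := eqVneq M set0; first by exists 1; [exact: ltr01 | move=> t []].
have [m _ mmax] := compact_EVT_max M0 cM (continuous_subspaceT (continuous_sqdist (p := p))).
have dm0 : 0 <= sqdist p m by rewrite addr_ge0 ?sqr_ge0.
(* With [D] the greatest squared distance from [p] over [M], the square of [D + 1] exceeds [D]. *)
exists (sqdist p m + 1); first by rewrite ltr_wpDl.
by move=> t /mem_set/mmax; rewrite sqdist_cis leNgt => /negP; apply; nra.
Qed.

(** [K] contains the boundary of [V]. With [b] an extension of [a] to the plane, [cis b / H] on [V]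
    and [dir p ^ n] off [V] glue to a continuous unimodular [phi] on the plane. Up to a constant
    [phi] has an argument on every compact set; on a circle outside [M] this says that [dir p ^ n]
    does not wind. *)
Lemma dir_exp_boundary K V M p (n : int) (H : R[i] -> R[i]) (a : R[i] -> R) :
    compact K -> open V -> V `&` K = set0 -> closure V `<=` V `|` K ->
    compact M -> V `<=` M -> V p -> {within K, continuous a} ->
    (forall z, (V `|` K) z -> {for z, continuous H} /\ `|H z| = 1) ->
    (forall z, K z -> dir p z ^ n * H z = cis (a z)) ->
  n = 0.
Proof.
move=> cK oV VK clV cM VM Vp ca hH ha.
have [b cb ab] := compact_continuous_extension cK ca.
have H0 z : (V `|` K) z -> H z != 0.
  by move=> /hH[_ h]; rewrite -normr_eq0 h oner_neq0.
pose f1 z := cis (b z) / H z; pose f2 z := dir p z ^ n.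
pose phi z := if `[< V z >] then f1 z else f2 z.
have phiV z : V z -> phi z = f1 z by rewrite /phi => /asboolT ->.
have phiN z : ~ V z -> phi z = f2 z by rewrite /phi => /asboolF ->.
have zp z : ~ V z -> z != p by move=> Vz; apply/eqP => zp; rewrite zp in Vz.
have c1 z : (V `|` K) z -> {for z, continuous f1}.
  move=> VKz; have [cH _] := hH z VKz.
  have h : cis (b w) @[w --> z] --> cis (b z).
    exact: (cvg_comp _ _ (cb z) (@continuous_cis R (b z))).
  exact: (cvgM h (cvgV (H0 z VKz) cH)).
have c2 z : ~ V z -> {for z, continuous f2}.
  by move=> /zp zp'; apply: continuous_exprz; [exact: dir_neq0 | exact: continuous_dir].
have cphi : continuous phi.
  move=> z; have [Vz|Vz] := pselect (V z).
    move=> P; rewrite phiV// => /(c1 z (or_introl Vz)) hP.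
    apply: filterS2 (open_nbhs_nbhs (conj oV Vz)) hP => w Vw /=.
    by rewrite /= phiV.
  have [clVz|clVz] := pselect (closure V z); last first.
    have oC : open (~` closure V) by apply/closed_openC/closed_closure.
    move=> P; rewrite phiN// => /(c2 z Vz) hP.
    apply: filterS2 (open_nbhs_nbhs (conj oC clVz)) hP => w Vw /=.
    by rewrite phiN// => /subset_closure.
  have Kz : K z by have [] := clV z clVz.
  (* At a boundary point the equation for [a] makes the two formulas agree; nearby, [phi] takes the
     value of one or the other, and both tend to this common value. *)
  have f12 : f1 z = f2 z.
    apply: (mulIf (H0 z (or_intror Kz))).
    by rewrite /f1 /f2 ha// divfK ?ab// H0//; right.
  move=> P; rewrite phiN// => Pz; have := Pz; rewrite -f12 => /(c1 z (or_intror Kz)) h1.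
  have h2 := c2 z Vz _ Pz.
  have {}h1 : nbhs z (fun w => P (f1 w)) := h1.
  have {}h2 : nbhs z (fun w => P (f2 w)) := h2.
  apply: filterS2 h1 h2 => w h1w h2w; rewrite /= /phi.
  by case: asboolP.
have phi1 z : `|phi z| = 1.
  have [Vz|Vz] := pselect (V z).
    by rewrite phiV// normrM normfV norm_cis (hH z _).2 ?invr1 ?mulr1//; left.
  by rewrite phiN// /f2 norm_exprz1// norm_dir// zp.
have [r r0 Mr] := circle_avoids_compact p cM.
pose K' := [set z : R[i] | (Re p - r <= Re z <= Re p + r) && (Im p - r <= Im z <= Im p + r)].
have cK' : compact K' by exact: rect_compact.
have [a' ca' ha'] := has_arg_compact p cK' cphi phi1.
have K'c t : K' (p + r%:C * cis t).
  rewrite /K' /= !raddfD /= !(mul0r, subr0, addr0).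
  have := cos_le1 t; have := cos_geN1 t; have := sin_le1 t; have := sin_geN1 t.
  by move=> *; apply/andP; split; apply/andP; split; nra.
have p0 : phi p != 0 by rewrite -normr_eq0 phi1 oner_neq0.
apply: (dir_exp_arg (p := p) (n := n) r0 p0 K'c ca') => t.
rewrite -ha'// [phi p * _]mulrC divfK// phiN//.
by move=> /VM; exact: Mr.
Qed.

End exponent_zero.

(** * Components of preimages under open maps *)

Lemma component_mono (T : topologicalType) (A B : set T) (x y : T) : A `<=` B ->
  connected_component A x y -> connected_component B x y.
Proof.
by move=> AB [C [Cx CA cC] Cy]; exists C => //; split=> //; exact: subset_trans AB.
Qed.

Section open_maps.
Context {R : realType}.
Implicit Types (z w p q y : R[i]) (K O V S A : set R[i]).

(** The component of [w] is open, so it meets the component of [z] in whose closure [w] lies. *)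
Lemma component_closed_in A z w : open A -> A w ->
  closure (connected_component A z) w -> connected_component A z w.
Proof.
move=> oA Aw clw.
have nw := open_nbhs_nbhs (conj (@component_open _ _ w oA) (connected_component_refl Aw)).
have [v [zv wv]] := clw _ nw.
exact: connected_component_trans zv (connected_component_sym wv).
Qed.

Lemma finite_components (Y A : set R[i]) : compact Y -> open A -> Y `<=` A ->
  exists s : seq R[i], forall z, Y z -> exists2 t, t \in s & connected_component A z t.
Proof.
rewrite compact_cover => cY oA YA.
have [||D' _ D'Y] := cY _ Y (connected_component A).
- by move=> t _; exact: component_open.
- by move=> z Yz; exists z => //; exact/connected_component_refl/YA.
exists (finmap.enum_fset D') => z /D'Y[t tD' tz]; exists t => //.
exact: connected_component_sym.
Qed.

(** [UD] keeps the boundary of [U] away from the preimage of [D]; with [closure U] compact this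
    makes [g] proper over [D]. *)
Variables (g : R[i] -> R[i]) (Om U D : set R[i]).
Hypotheses (cg : forall z, Om z -> {for z, continuous g})
  (og : forall W, open W -> W `<=` Om -> open (g @` W))
  (oU : open U) (cU : compact (closure U)) (UOm : closure U `<=` Om)
  (UD : forall z, closure U z -> D (g z) -> U z).

Let UOm' : U `<=` Om := subset_trans (@subset_closure _ U) UOm.

Lemma open_preimage S : open S -> open (U `&` g @^-1` S).
Proof.
move=> oS; rewrite openE => z [Uz Sz].
apply: filterI; first exact: open_nbhs_nbhs.
by apply: (cg (UOm' Uz)); exact: open_nbhs_nbhs.
Qed.

Lemma continuous_within_closure : {within closure U, continuous g}.
Proof.
apply: continuous_in_subspaceT => z; rewrite inE => /UOm; exact: cg.
Qed.

Lemma component_onto S z y : open S -> connected S -> S `<=` D ->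
  U z -> S (g z) -> S y ->
  exists2 w, connected_component (U `&` g @^-1` S) z w & g w = y.
Proof.
move=> oS cS SD Uz Sz Sy.
set A := U `&` g @^-1` S; set C := connected_component A z.
have oA : open A := open_preimage oS.
have CA : C `<=` A by exact: connected_component_sub.
have oC : open C by exact: component_open.
pose P y := exists2 w, C w & g w = y.
apply: (connected_ind (P := P) cS Sz _ _ Sy).
  by exists z => //; exact: connected_component_refl.
move=> {Sy}y Sy; rewrite near_withinE; have [Py|nPy] := pselect (P y).
  have ogC : open (g @` C) by apply: og => // w /CA[/UOm'].
  have gCy : (g @` C) y by case: Py => w Cw <-; exists w.
  by apply: filterS (open_nbhs_nbhs (conj ogC gCy)) => y' [w Cw wy'] _; split=> // _; exists w.
have CU : closure C `<=` closure U by apply: closureS => w /CA[].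
have clgC : closed (g @` closure C).
  apply: compact_closed; first exact: complex_hausdorff.
  apply: continuous_compact.
    by apply: continuous_in_subspaceT => w; rewrite inE => /CU/UOm; exact: cg.
  by apply: subclosed_compact cU CU; exact: closed_closure.
have gCy : (~` (g @` closure C)) y.
  move=> [w clw wy]; apply: nPy; exists w => //.
  apply: component_closed_in => //; split; last by rewrite /= wy.
  by apply: UD; [exact: CU | rewrite wy; exact: SD].
apply: filterS (open_nbhs_nbhs (conj (closed_openC clgC) gCy)) => y' nCy' _.
by split => // -[w Cw wy']; exfalso; apply: nCy'; exists w => //; exact: subset_closure.
Qed.

(* The same representatives serve every larger connected set [S], since a component
   over [S] meets the fiber of [y]. *)
Lemma component_representatives S0 y : open S0 -> S0 `<=` D -> S0 y ->
  exists s : seq R[i], forall S z, open S -> connected S -> S `<=` D ->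
    S0 `<=` S -> U z -> S (g z) ->
  exists2 t, t \in s & connected_component (U `&` g @^-1` S) z t.
Proof.
move=> oS0 S0D S0y.
have cY : compact (closure U `&` g @^-1` [set y]).
  apply: subclosed_compact cU _ => [|z []//].
  apply: closed_within_preimage continuous_within_closure _; first exact: closed_closure.
  by apply: compact_closed; [exact: complex_hausdorff | exact: compact_set1].
have [|s sP] := finite_components cY (open_preimage oS0).
  by move=> z [Uz /= yz]; split; rewrite /= ?yz//; apply: UD => //; rewrite yz; exact: S0D.
exists s => S z oS cS SD S0S Uz Sz.
have [w zw wy] := component_onto oS cS SD Uz Sz (S0S _ S0y).
have Uw : U w by have [] := connected_component_sub zw.
have [t ts wt] := sP w (conj (subset_closure Uw) wy).
exists t => //; apply: connected_component_trans zw _.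
by apply: component_mono wt => v [? /S0S].
Qed.

End open_maps.

(** * Diamonds, quadrants and the l1 norm *)

Section sectors.
Context {R : realType}.
Implicit Types (y z w : R[i]) (r s t e : R) (A W : set R[i]).

Definition l1 y : R := `|Re y| + `|Im y|.

Definition diamond r := [set y | l1 y < r].

Definition quadrant s t : set R[i] := [set y | 0 < s * Re y /\ 0 < t * Im y].

Definition sector s t r r0 := quadrant s t `&` [set y | r < l1 y < r0].

Definition petal s t r r0 := (quadrant s t `&` diamond r0) `|` diamond r.

Definition is_sign s := s = 1 \/ s = -1.

Lemma continuous_l1 : continuous l1.
Proof.
move=> z.
have hr : `|Re w| @[w --> z] --> `|Re z| by exact: (cvg_norm (@continuous_Re R z)).
have hi : `|Im w| @[w --> z] --> `|Im z| by exact: (cvg_norm (@continuous_Im R z)).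
exact: (cvgD hr hi).
Qed.

Lemma open_diamond r : open (diamond r).
Proof. by move/continuousP: continuous_l1 => /(_ _ (@open_lt _ r)). Qed.

Lemma open_quadrant s t : open (quadrant s t).
Proof.
apply: openI.
  have c : continuous (fun z : R[i] => s * Re z).
    by move=> z; exact: (cvgM (@cvg_cst _ s _ (nbhs z) _) (@continuous_Re R z)).
  by move/continuousP: c => /(_ _ (@open_gt _ 0)).
have c : continuous (fun z : R[i] => t * Im z).
  by move=> z; exact: (cvgM (@cvg_cst _ t _ (nbhs z) _) (@continuous_Im R z)).
by move/continuousP: c => /(_ _ (@open_gt _ 0)).
Qed.

Lemma open_sector s t r r0 : open (sector s t r r0).
Proof.
apply: openI; first exact: open_quadrant.
rewrite (_ : [set _ | _] = l1 @^-1` [set x | r < x] `&` diamond r0).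
  apply: openI; last exact: open_diamond.
  by move/continuousP: continuous_l1 => /(_ _ (@open_gt _ r)).
by apply/seteqP; split => y /=; [move/andP | case=> a b; apply/andP].
Qed.

Lemma open_petal s t r r0 : open (petal s t r r0).
Proof.
apply: openU; last exact: open_diamond.
by apply: openI; [exact: open_quadrant | exact: open_diamond].
Qed.

Lemma l1_convex z w t : 0 <= t <= 1 ->
  l1 ((Re z + t * (Re w - Re z)) +i* (Im z + t * (Im w - Im z))) <=
  l1 z + t * (l1 w - l1 z).
Proof.
move=> /andP[t0 t1].
have K (x y : R) : `|x + t * (y - x)| <= `|x| + t * (`|y| - `|x|).
  rewrite (_ : x + _ = (1 - t) * x + t * y); last by ring.
  apply: le_trans (ler_normD _ _) _; rewrite !normrM (ger0_norm t0) ger0_norm ?subr_ge0//.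
  by rewrite le_eqVlt; apply/orP; left; apply/eqP; ring.
rewrite /l1 /=; have := K (Re z) (Re w); have := K (Im z) (Im w); lra.
Qed.

Lemma quadrant_convex s s' z w t : 0 <= t <= 1 -> quadrant s s' z -> quadrant s s' w ->
  quadrant s s' ((Re z + t * (Re w - Re z)) +i* (Im z + t * (Im w - Im z))).
Proof.
move=> t01 [z1 z2] [w1 w2]; split => /=.
  by have := convex_gt0 z1 w1 t01; congr (_ < _); ring.
by have := convex_gt0 z2 w2 t01; congr (_ < _); ring.
Qed.

Lemma quadrant_l1 s t y : is_sign s -> is_sign t -> quadrant s t y ->
  l1 y = s * Re y + t * Im y.
Proof.
have K a x : is_sign a -> 0 < a * x -> `|x| = a * x.
  case=> ->; first by rewrite mul1r => /gtr0_norm.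
  by rewrite mulN1r oppr_gt0 => /ltr0_norm.
by move=> hs ht [h1 h2]; rewrite /l1 (K s)// (K t).
Qed.

Lemma diamond_connected r : connected (diamond r).
Proof.
apply: convex_connected => z w t zr wr t01.
apply: le_lt_trans (l1_convex z w t01) _.
have h1 : 0 < r - l1 z by rewrite subr_gt0.
have h2 : 0 < r - l1 w by rewrite subr_gt0.
have := convex_gt0 h1 h2 t01; lra.
Qed.

(** On a quadrant the l1 norm is linear, so what remains after removing the inner diamond is still
    convex; this is where diamonds serve better than discs. *)
Lemma sector_connected s t r r0 : is_sign s -> is_sign t -> connected (sector s t r r0).
Proof.
move=> hs ht; apply: convex_connected => z w u [qz /andP[z1 z2]] [qw /andP[w1 w2]] u01.
have qv := quadrant_convex u01 qz qw.
split=> //; apply/andP; split.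
  rewrite (quadrant_l1 hs ht qv) /=.
  have h1 : 0 < s * Re z + t * Im z - r by rewrite -quadrant_l1// subr_gt0.
  have h2 : 0 < s * Re w + t * Im w - r by rewrite -quadrant_l1// subr_gt0.
  by rewrite -subr_gt0; have := convex_gt0 h1 h2 u01; congr (_ < _); ring.
apply: le_lt_trans (l1_convex z w u01) _; rewrite -subr_gt0.
have h1 : 0 < r0 - l1 z by rewrite subr_gt0.
have h2 : 0 < r0 - l1 w by rewrite subr_gt0.
by have := convex_gt0 h1 h2 u01; congr (_ < _); ring.
Qed.

(** The point on the diagonal of the quadrant with l1 norm [(r + r0) / 2]. *)
Lemma sector_point s t r r0 : is_sign s -> is_sign t -> 0 <= r < r0 ->
  sector s t r r0 ((s * (r + r0) / 4) +i* (t * (r + r0) / 4)).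
Proof.
move=> hs ht /andP[r0' rr].
have q : quadrant s t ((s * (r + r0) / 4) +i* (t * (r + r0) / 4)).
  by split => /=; [case: hs => -> | case: ht => ->]; lra.
split=> //; apply/andP; rewrite (quadrant_l1 hs ht q) /=.
by case: hs {q} => ->; case: ht => ->; split; lra.
Qed.

Lemma petal_connected s t r r0 : is_sign s -> is_sign t -> 0 < r < r0 ->
  connected (petal s t r r0).
Proof.
move=> hs ht /andP[r0' rr]; apply: connectedU; last exact: diamond_connected.
  have [q /andP[h1 h2]] : sector s t 0 r ((s * (0 + r) / 4) +i* (t * (0 + r) / 4)).
    by apply: sector_point => //; rewrite lexx.
  eexists; split; last exact: h2.
  by split; [exact: q | exact: lt_trans rr].
apply: convex_connected => z w u [qz zr] [qw wr] u01; split.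
  exact: quadrant_convex.
apply: le_lt_trans (l1_convex z w u01) _; rewrite -subr_gt0.
have h1 : 0 < r0 - l1 z by rewrite subr_gt0.
have h2 : 0 < r0 - l1 w by rewrite subr_gt0.
by have := convex_gt0 h1 h2 u01; congr (_ < _); ring.
Qed.

Lemma sector_petal s t r r0 : sector s t r r0 `<=` petal s t r r0.
Proof. by move=> y [qy /andP[_ h]]; left. Qed.

Lemma petal_diamond s t r r0 : r <= r0 -> petal s t r r0 `<=` diamond r0.
Proof. by move=> rr y [[]//|]; rewrite /diamond /=; move/lt_le_trans; apply. Qed.

Lemma sector_diamond s t r r0 : sector s t r r0 `<=` diamond r0.
Proof. by move=> y [_ /andP[]]. Qed.

Lemma sector_mono s t r r' r0 : r <= r' -> sector s t r' r0 `<=` sector s t r r0.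
Proof.
by move=> rr y [qy /andP[h1 h2]]; split=> //; rewrite /= h2 (le_lt_trans rr).
Qed.

(** Push the real part away from 0. Hence [l1] composed with an open map has no local maximum. *)
Lemma l1_increase y W : nbhs y W -> exists2 w, W w & l1 y < l1 w.
Proof.
move=> /nbhs_complexP[e e0 eW].
have [y0|y0] := lerP 0 (Re y).
  exists ((Re y + e / 2) +i* Im y).
    apply: eW => /=; last by rewrite subrr normr0.
    by rewrite addrAC subrr add0r gtr0_norm; lra.
  by rewrite /l1 /= ltrD2r ger0_norm// ger0_norm; lra.
exists ((Re y - e / 2) +i* Im y).
  apply: eW => /=; last by rewrite subrr normr0.
  by rewrite addrAC subrr add0r normrN gtr0_norm; lra.
by rewrite /l1 /= ltrD2r ltr0_norm// ltr0_norm; lra.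
Qed.

(** Outside the open first and third quadrants, [y] lies in the closed second or fourth one; moving
    both coordinates away from the axes enters the open quadrant and increases the l1 norm beyond
    [r]. *)
Lemma sector_gap r r0 y W : 0 < r -> r <= l1 y < r0 ->
  ~ quadrant 1 1 y -> ~ quadrant (-1) (-1) y -> nbhs y W ->
  exists2 w, W w & sector 1 (-1) r r0 w \/ sector (-1) 1 r r0 w.
Proof.
move=> r_gt0 /andP[ry yr0] q1 q3 /nbhs_complexP[e e0 eW].
(* Moving each coordinate by [m] raises the l1 norm by [2 m]; the bound [(r0 - l1 y) / 4] keeps it
   below [r0], and [e / 2] stays in [W]. *)
have m0 : 0 < Num.min (e / 2) ((r0 - l1 y) / 4) by rewrite lt_min; apply/andP; split; lra.
have me : Num.min (e / 2) ((r0 - l1 y) / 4) < e by rewrite gt_min; apply/orP; left; lra.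
have mr : Num.min (e / 2) ((r0 - l1 y) / 4) <= (r0 - l1 y) / 4 by rewrite ge_min lexx orbT.
move: (Num.min _ _) m0 me mr => m m0 me mr.
move: y => [a b] in ry yr0 q1 q3 eW mr *.
rewrite /l1 /= in ry yr0 mr.
have [[a0 b0]|[a0 b0]] : (a <= 0 /\ 0 <= b) \/ (0 <= a /\ b <= 0).
  have {}q1 : ~ (0 < a /\ 0 < b) by move=> [? ?]; apply: q1; split; rewrite /= mul1r.
  have {}q3 : ~ (a < 0 /\ b < 0).
    by move=> [? ?]; apply: q3; split; rewrite /= mulN1r oppr_gt0.
  have [a0|a0] := lerP a 0; have [b0|b0] := lerP b 0.
  - have [a1|a1] := ltP a 0; have [b1|b1] := ltP b 0.
    + by exfalso; apply: q3.
    + by left; split.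
    + by right; split.
    + by left; split.
  - by left; split=> //; exact: ltW.
  - by right; split=> //; exact: ltW.
  - by exfalso; apply: q1.
- have [e1 e2] : `|a - m| = m - a /\ `|b + m| = b + m.
    by split; [rewrite ler0_norm; lra | rewrite ger0_norm; lra].
  exists ((a - m) +i* (b + m)).
    by apply: eW; rewrite /= addrAC subrr add0r ?normrN gtr0_norm.
  right; split; first by split => /=; lra.
  rewrite (ler0_norm a0) (ger0_norm b0) in ry yr0 mr.
  by rewrite /l1 /= e1 e2; apply/andP; split; lra.
have [e1 e2] : `|a + m| = a + m /\ `|b - m| = m - b.
  by split; [rewrite ger0_norm; lra | rewrite ler0_norm; lra].
exists ((a + m) +i* (b - m)).
  by apply: eW; rewrite /= addrAC subrr add0r ?normrN gtr0_norm.
left; split; first by split => /=; lra.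
rewrite (ger0_norm a0) (ler0_norm b0) in ry yr0 mr.
by rewrite /l1 /= e1 e2; apply/andP; split; lra.
Qed.

End sectors.

(** * Counting preimages of a point *)

(** Over the rationals [c + 1] vectors in dimension [c] are dependent; multiplying the coefficients
    by the product of their denominators makes them integers. *)
Lemma int_kernel (c : nat) (d : 'I_c.+1 -> 'I_c -> int) :
  exists2 n : 'I_c.+1 -> int, (exists k, n k != 0) &
    forall j, \sum_k n k * d k j = 0.
Proof.
pose A : 'M[rat]_(c.+1, c) := \matrix_(k, j) (d k j)%:~R.
have : kermx A != 0.
  rewrite kermx_eq0 /row_free; apply/negP => /eqP rA.
  by have := rank_leq_col A; rewrite rA ltnn.
move=> /rowV0Pn[v /sub_kermxP vA v0].
pose n k := numq (v 0 k) * \prod_(j | j != k) denq (v 0 j).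
have nE k : (n k)%:~R = (\prod_j denq (v 0 j))%:~R * v 0 k :> rat.
  by rewrite (bigD1 k) //= /n !intrM numqE; ring.
exists n.
  have [k vk] : exists k, v 0 k != 0.
    apply/existsP; apply: contraNT v0 => /existsPn vk; apply/eqP/rowP => k.
    by have := vk k; rewrite negbK mxE => /eqP.
  exists k; rewrite -(intr_eq0 rat) nE mulf_neq0// intr_eq0.
  by apply/prodf_neq0 => j _; exact: denq_neq0.
move=> j; apply/eqP; rewrite -(intr_eq0 rat) rmorph_sum /=.
have /rowP/(_ j) := vA; rewrite !mxE => vAj.
rewrite (eq_bigr (fun k => (\prod_j denq (v 0 j))%:~R * (v 0 k * A k j))).
  by rewrite -mulr_sumr vAj mulr0.
by move=> k _; rewrite intrM nE mulrA mxE.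
Qed.

(** * Circles and discs *)

Section circles.
Context {R : realType}.
Implicit Types (p z w : R[i]) (a r : R).

(** Subtracting the integer part of [a / (2 pi)] leaves an angle in [[0, 2 pi)], which is 0 by
    [cis_inj]. *)
Lemma cis_eq1 a : cis a = 1 -> exists d : int, a = pi *+ 2 * d%:~R.
Proof.
move=> a1; have pi2 : 0 < pi *+ 2 :> R by rewrite pmulrn_lgt0 ?pi_gt0.
pose d := Num.floor (a / (pi *+ 2)); exists d.
have /andP[d1 d2] := Num.Theory.floor_itv (a / (pi *+ 2)).
rewrite -/d ler_pdivlMr// in d1; rewrite -/d ltr_pdivrMr// in d2.
apply/eqP; rewrite -subr_eq0; apply/eqP/cis_inj.
  rewrite cisD a1 mul1r cis0 cisN mulrzr cisMz cis2pi exp1rz invr1 //.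
rewrite subr0 ger0_norm; last by rewrite subr_ge0 mulrC.
by rewrite ltrBlDr; move: d2; rewrite intrD mulrDl mul1r mulrC [X in _ -> _ < X]addrC.
Qed.

Lemma cis_surj z : `|z| = 1 -> exists a, z = cis a.
Proof.
case: z => x y; rewrite normc_def /= => -[h].
have xy : x ^+ 2 + y ^+ 2 = 1.
  by rewrite -[LHS]sqr_sqrtr ?h ?expr1n// addr_ge0 ?sqr_ge0.
have x1 : -1 <= x <= 1 by apply/andP; split; nra.
have s : Num.sqrt (1 - x ^+ 2) = `|y| by rewrite -xy addrAC subrr add0r sqrtr_sqr.
have [y0|y0] := lerP 0 y.
  by exists (acos x); rewrite /cis sin_acos// acosK ?in_itv//= s ger0_norm.
exists (- acos x); rewrite /cis sinN cosN sin_acos// acosK ?in_itv//= s ltr0_norm//.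
by rewrite opprK.
Qed.

Definition cdisk p r := [set z | sqdist p z <= r ^+ 2].
Definition odisk p r := [set z | sqdist p z < r ^+ 2].
Definition circle p r := [set z | sqdist p z = r ^+ 2].

Lemma circle_cis p r z : 0 < r -> circle p r z -> exists a, z = p + r%:C * cis a.
Proof.
move=> r0 zr; have rC : r%:C != 0 by rewrite eq_complex /= negb_and gt_eqF.
have [a za] : exists a, (z - p) / r%:C = cis a.
  apply: cis_surj; rewrite normrM normfV [`|r%:C|]ger0_norm ?lecR ?ltW//.
  rewrite normc_def !raddfB /= -/(sqdist p z) zr sqrtr_sqr gtr0_norm//.
  by rewrite divff.
by exists a; rewrite -za mulrC divfK// addrC subrK.
Qed.

Lemma circle_connected p r : 0 < r -> connected (circle p r).
Proof.
move=> r0; pose gam a := p + r%:C * cis a.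
have -> : circle p r = gam @` [set: R].
  apply/seteqP; split => [z /(circle_cis r0)[a ->]|_ [a _ <-]]; first by exists a.
  exact: sqdist_cis.
apply: connected_continuous_connected.
  by apply/connected_intervalP => x y _ _ z _.
apply: continuous_subspaceT => t; have h : (r%:C * cis s) @[s --> t] --> r%:C * cis t.
  exact: (cvgM (@cvg_cst _ r%:C _ (nbhs t) _) (@continuous_cis R t)).
exact: (cvgD (@cvg_cst _ p _ (nbhs t) _) h).
Qed.

Lemma odisk_open p r : open (odisk p r).
Proof. by move/continuousP: (@continuous_sqdist R p) => /(_ _ (@open_lt _ (r ^+ 2))). Qed.

Lemma cdisk_bound p r z : 0 < r -> cdisk p r z ->
  `|Re z - Re p| <= r /\ `|Im z - Im p| <= r.
Proof.
rewrite /cdisk /sqdist /= => r0 h.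
have K (x y : R) : x ^+ 2 + y ^+ 2 <= r ^+ 2 -> `|x| <= r.
  move=> xy; have xr : x ^+ 2 <= r ^+ 2 by apply: le_trans xy; rewrite lerDl sqr_ge0.
  by rewrite ler_norml; apply/andP; split; nra.
by split; [exact: K h | by apply: (K _ (Re z - Re p)); rewrite addrC].
Qed.

Lemma cdisk_compact p r : 0 < r -> compact (cdisk p r).
Proof.
move=> r0; have cR : compact [set z : R[i] |
    (Re p - r <= Re z <= Re p + r) && (Im p - r <= Im z <= Im p + r)] by exact: rect_compact.
apply: subclosed_compact cR _.
  by move/continuous_closedP: (@continuous_sqdist R p) => /(_ _ (@closed_le _ (r ^+ 2))).
by move=> z /(cdisk_bound r0)[]; rewrite !ler_norml => h1 h2; apply/andP; split; lra.
Qed.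

Lemma cdisk_nbhs p (W : set R[i]) : nbhs p W -> exists2 r, 0 < r & cdisk p r `<=` W.
Proof.
move=> /nbhs_complexP[e e0 eW]; exists (e / 2); first by rewrite divr_gt0.
have e2 : 0 < e / 2 by rewrite divr_gt0.
by move=> z /(cdisk_bound e2)[h1 h2]; apply: eW; lra.
Qed.

End circles.

(** * Bounded clopen parts of the complement of the two petals' preimages *)

Section holes.
Context {R : realType}.
Implicit Types (z w p q y : R[i]) (K O V S A : set R[i]) (r s t : R).

Lemma sector_quadrant_disjoint s t s' t' r r0 r' r0' y :
  is_sign s -> is_sign t -> is_sign s' -> is_sign t' -> (s != s') || (t != t') ->
  r' <= r -> sector s t r r0 y -> petal s' t' r' r0' y -> False.
Proof.
move=> hs ht hs' ht' d rr [[h1 h2] /andP[h3 _]] [[[h4 h5] _]|h4]; last first.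
  by move: (lt_trans (lt_le_trans h4 rr) h3); rewrite ltxx.
by move: d; case: hs h1 => ->; case: ht h2 => ->; case: hs' h4 => ->; case: ht' h5 => ->;
  rewrite ?eqxx //= => *; lra.
Qed.

Variables (g : R[i] -> R[i]) (Om U : set R[i]) (r0 : R).
Hypotheses (cg : forall z, Om z -> {for z, continuous g})
  (og : forall W, open W -> W `<=` Om -> open (g @` W))
  (oU : open U) (UOm : closure U `<=` Om)
  (UD : forall z, closure U z -> diamond r0 (g z) -> U z).

Let UOm' : U `<=` Om := subset_trans (@subset_closure _ U) UOm.

(** The quadrants that the petals leave out: the fourth for [d = false], the second for
    [d = true]. *)
Definition opposite_sector (d : bool) r := sector ((-1) ^+ d) (- (-1) ^+ d) r r0 : set R[i].

(* At a maximum over [E] of [l1 \o g], openness of [g] forces the surrounding part of the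
   neighbourhood to lie in [O], so that the maximum is attained inside [U]. *)
Lemma hole_contains_sector r E : 0 < r <= r0 ->
  let O := U `&` g @^-1` (petal 1 1 r r0 `|` petal (-1) (-1) r r0) in
  compact E -> E `<=` Om -> E !=set0 -> E `&` O = set0 ->
  (forall e, E e -> nbhs e (E `|` O)) ->
  exists d : bool, exists z, [/\ U z, opposite_sector d r (g z) &
    connected_component (U `&` g @^-1` opposite_sector d r) z `<=` E].
Proof.
move=> /andP[rp rr0] O cE EOm E0 EO nE.
have clE : closed E := compact_closed (@complex_hausdorff R) cE.
have cl1 : {within E, continuous (fun z => l1 (g z))}.
  apply: continuous_in_subspaceT => z; rewrite inE => Ez.
  exact: (cvg_comp _ _ (cg (EOm _ Ez)) (@continuous_l1 R (g z))).
have [e Ee emax] := compact_EVT_max E0 cE cl1; rewrite inE in Ee.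
have OD z : O z -> l1 (g z) < r0 by move=> [_ []]; exact: petal_diamond.
(* Openness of [g] gives points near [e], in [E] or in [O], with a larger [l1 (g z)]; maximality of
   [e] rules out [E]. *)
have bigger V : nbhs e V -> V `<=` Om -> exists z, [/\ V z, O z & l1 (g e) < l1 (g z)].
  move=> Ve VOm; pose W := interior (V `&` (E `|` O)).
  have We : W e by apply: filterI => //; exact: nE.
  have WV : W `<=` V `&` (E `|` O) by exact: interior_subset.
  have oW : open (g @` W) by apply: og; [exact: open_interior | move=> z /WV[/VOm]].
  have gWe : (g @` W) (g e) by exists e.
  have [_ [z Wz <-] ez] := l1_increase (open_nbhs_nbhs (conj oW gWe)).
  have [Vz [Ez|Oz]] := WV z Wz; last by exists z.
  by have := emax z (mem_set Ez); rewrite leNgt ez.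
have nOme : exists2 V, nbhs e V & V `<=` Om.
  exists (E `|` O); first exact: nE.
  by move=> z [/EOm//|[/UOm']].
have [V0 V0e V0Om] := nOme.
have ger0 : l1 (g e) < r0.
  by have [z [_ /OD zr ez]] := bigger V0 V0e V0Om; exact: lt_trans ez zr.
(* Points of [O], hence of [U], accumulate at [e], and [UD] applies since [l1 (g e) < r0]. *)
have Ue : U e.
  apply: UD ger0 => B Be.
  have [||z [[Bz _] [Uz _] _]] := bigger (B `&` V0); last by exists z.
    exact: filterI.
  by move=> z [_ /V0Om].
have nOe : ~ O e by move=> Oe; move/seteqP: EO => [/(_ e)+ _]; apply.
have nP : ~ (petal 1 1 r r0 `|` petal (-1) (-1) r r0) (g e).
  by move=> h; apply: nOe.
have re : r <= l1 (g e).
  by rewrite leNgt; apply/negP => h; apply: nP; left; right.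
pose W := interior (U `&` (E `|` O)).
have We : W e by apply: filterI; [exact: open_nbhs_nbhs | exact: nE].
have WV : W `<=` U `&` (E `|` O) by exact: interior_subset.
have oW : open (g @` W) by apply: og; [exact: open_interior | move=> z /WV[/UOm']].
have gWe : (g @` W) (g e) by exists e.
have [|||_ [z Wz <-] Sz] := sector_gap rp _ _ _ (open_nbhs_nbhs (conj oW gWe)) (r0 := r0).
- by rewrite re ger0.
- by move=> h; apply: nP; left; left.
- by move=> h; apply: nP; right; left.
have [d Sd] : exists d : bool, opposite_sector d r (g z).
  case: Sz => h; [exists false | exists true]; rewrite /opposite_sector ?expr0 ?expr1 ?opprK//.
have dis w : opposite_sector d r (g w) -> ~ O w.
  have i1 : is_sign (1 : R) by left.
  have im1 : is_sign (-1 : R) by right.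
  have ne : (1 != -1 :> R) by apply/eqP; lra.
  case: d {Sd} => /=; rewrite /opposite_sector ?expr0 ?expr1 ?opprK => h [_ [h'|h']];
    apply: (sector_quadrant_disjoint _ _ _ _ _ (lexx r) h h') => //;
    by rewrite ?ne ?[-1 == 1]eq_sym ?ne ?orbT.
have [Uz [Ez|Oz]] := WV z Wz; last by case: (dis z).
exists d, z; split=> // w zw.
set C := connected_component _ z in zw.
have Cz : C z by apply: connected_component_refl.
(* The component over the sector misses [O], so [E], closed and with [E] and [O] together around
   each of its points, is clopen in it. *)
apply: (connected_ind (P := E) (@component_connected _ _ z) Cz Ez _ zw) => v Cv.
rewrite near_withinE; have [Ev|Ev] := pselect (E v).
  apply: filterS (nE v Ev) => u EOu Cu; split=> // _.
  by case: EOu => // Ou; case: (dis u) => //; have [_] := connected_component_sub Cu.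
by apply: filterS (open_nbhs_nbhs (conj (closed_openC clE) Ev)) => u Eu _; split.
Qed.

End holes.

(** * Contradiction from too many pairs *)

Section pairs.
Context {R : realType}.
Implicit Types (z w y : R[i]) (K O V S A E : set R[i]).

Lemma within_continuous_sum (T : topologicalType) (A : set T) (I : Type)
    (s : seq I) (f : I -> T -> R) :
  (forall i, {within A, continuous (f i)}) ->
  {within A, continuous (fun x => \sum_(i <- s) f i x)}.
Proof.
move=> cf; elim: s => [|i s IH].
  have -> : (fun x => \sum_(i <- [::]) f i x) = (fun=> 0).
    by apply/funext => x; rewrite big_nil.
  exact/continuous_subspaceT/cst_continuous.
have -> : (fun x => \sum_(i <- i :: s) f i x) = (fun x => f i x + \sum_(i <- s) f i x).
  by apply/funext => x; rewrite big_cons.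
by move=> x; apply: cvgD; [exact: cf | exact: IH].
Qed.

Lemma continuous_prod z (I : eqType) (s : seq I) (P : pred I) (f : I -> R[i] -> R[i]) :
  (forall i, P i -> {for z, continuous (f i)}) ->
  {for z, continuous (fun w => \prod_(i <- s | P i) f i w)}.
Proof.
move=> cf; elim: s => [|i s IH].
  have -> : (fun z => \prod_(i <- [::] | P i) f i z) = (fun=> 1).
    by apply/funext => w; rewrite big_nil.
  exact: (@cvg_cst _ (1 : R[i]) _ (nbhs z) _).
have [Pi|nPi] := boolP (P i); last first.
  have -> // : (fun w => \prod_(i <- i :: s | P i) f i w) = (fun w => \prod_(i <- s | P i) f i w).
  by apply/funext => w; rewrite big_cons (negbTE nPi).
have -> : (fun w => \prod_(i <- i :: s | P i) f i w) =
    (fun w => f i w * \prod_(i <- s | P i) f i w).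
  by apply/funext => w; rewrite big_cons Pi.
exact: (cvgM (cf i Pi) IH).
Qed.

(* The values of an arg of a constant lie in a coset of [2 pi Z], hence the level sets of
   [w] are clopen. *)
Lemma level_set_complement_closed A (w : R[i] -> R) c : closed A -> {within A, continuous w} ->
  (forall z, A z -> cis (w z) = cis c) -> closed (A `&` [set z | w z <> c]).
Proof.
move=> clA cw wc.
have -> : A `&` [set z | w z <> c] = A `&` w @^-1` [set x | pi *+ 2 <= `|x - c|].
  apply/seteqP; split => z [Az] /= wz; split=> //.
    by rewrite leNgt; apply/negP => /(cis_inj (wc z Az)).
  move=> e; move: wz; rewrite e subrr normr0 leNgt.
  by rewrite pmulrn_lgt0 ?pi_gt0.
apply: closed_within_preimage => //.
have cn : continuous (fun x : R => `|x - c|).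
  move=> x; have h : (y - c) @[y --> x] --> x - c.
    have hx : y @[y --> x] --> x by move=> P.
    exact: (cvgB hx (@cvg_cst _ c _ (nbhs x) _)).
  exact: (cvg_norm h).
by move/continuous_closedP: cn => /(_ _ (@closed_ge _ (pi *+ 2))).
Qed.

Lemma level_set_closed A (w : R[i] -> R) c : closed A -> {within A, continuous w} ->
  closed (A `&` [set z | w z = c]).
Proof.
move=> clA cw; apply: (closed_within_preimage clA cw (C := [set c])).
exact: closed_eq.
Qed.

Lemma constant_of_cis_constant A (w : R[i] -> R) z0 : closed A -> connected A ->
  {within A, continuous w} -> A z0 -> (forall z, A z -> cis (w z) = cis (w z0)) ->
  forall z, A z -> w z = w z0.
Proof.
move=> clA cA cw Az0 wz0.
apply: (connected_ind (P := fun z => w z = w z0) cA Az0) => // y Ay.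
have cl1 := level_set_complement_closed clA cw wz0.
have cl2 := @level_set_closed A w (w z0) clA cw.
rewrite near_withinE; have [wy|wy] := pselect (w y = w z0).
  have ny : (~` (A `&` [set z | w z <> w z0])) y by move=> [_].
  apply: filterS (open_nbhs_nbhs (conj (closed_openC cl1) ny)) => z nz Az; split=> // _.
  by apply: contrapT => h; apply: nz.
have ny : (~` (A `&` [set z | w z = w z0])) y by move=> [_].
apply: filterS (open_nbhs_nbhs (conj (closed_openC cl2) ny)) => z nz Az; split=> // h.
by exfalso; apply: nz.
Qed.

Variables (g : R[i] -> R[i]) (Om U : set R[i]) (r0 rho : R) (x0 : R[i]).
Hypotheses (cg : forall z, Om z -> {for z, continuous g})
  (og : forall W, open W -> W `<=` Om -> open (g @` W))
  (rho0 : 0 < rho) (diskOm : cdisk x0 rho `<=` Om)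
  (oU : open U) (Udisk : closure U `<=` odisk x0 rho)
  (UD : forall z, closure U z -> diamond r0 (g z) -> U z).

Let M := cdisk x0 rho.

Let oM : odisk x0 rho `<=` M.
Proof. by move=> z /ltW. Qed.

Let cM : compact M := cdisk_compact rho0.

Let clM : closed M := compact_closed (@complex_hausdorff R) cM.

Let cU : compact (closure U).
Proof. by apply: subclosed_compact cM (subset_trans Udisk oM); exact: closed_closure. Qed.

Let UOm : closure U `<=` Om := subset_trans (subset_trans Udisk oM) diskOm.

Let UM : U `<=` M := subset_trans (@subset_closure _ U) (subset_trans Udisk oM).

(** The points [ts] meet every component over the two opposite sectors. Each imposes one linear
    condition on the exponents, and [c + 1] pairs leave a nonzero solution, which the winding number
    argument then excludes. *)
Lemma no_many_pairs (r : R) (c : nat) (ts : 'I_c -> R[i]) (p q : 'I_c.+1 -> R[i]) :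
  0 < r <= r0 ->
  let over S := U `&` g @^-1` S in
  (forall d z, U z -> opposite_sector r0 d r (g z) ->
    exists j, connected_component (over (opposite_sector r0 d r)) z (ts j)) ->
  (forall k, over (diamond r) (p k) /\ over (diamond r) (q k)) ->
  (forall k, connected_component (over (petal 1 1 r r0)) (q k) (p k)) ->
  (forall k, connected_component (over (petal (-1) (-1) r r0)) (q k) (p k)) ->
  (forall k k', connected_component (over (diamond r)) (p k) (p k') -> k = k') ->
  (forall k k', ~ connected_component (over (diamond r)) (p k) (q k')) -> False.
Proof.
move=> rr over hts hpq h1 h2 hpp hpq'.
set O1 := over (petal 1 1 r r0) in h1; set O2 := over (petal (-1) (-1) r r0) in h2.
set O := over (diamond r) in hpq hpp hpq'.
have oP S : open S -> open (over S) by move=> oS; exact: (open_preimage cg oU UOm).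
have oO1 : open O1 by apply: oP; exact: open_petal.
have oO2 : open O2 by apply: oP; exact: open_petal.
have oO : open O by apply: oP; exact: open_diamond.
(* The two quadrants are disjoint, so the petals meet exactly in the small diamond. *)
have OE z : O z <-> O1 z /\ O2 z.
  split=> [[Uz gz]|[[Uz g1] [_ g2]]]; first by split; split=> //; right.
  split=> //; case: g1 => // -[[a1 a2] _]; case: g2 => // -[[b1 b2] _].
  by move: a1 b1; rewrite mul1r mulN1r => *; lra.
have argE (O' : set R[i]) k : open O' -> connected_component O' (q k) (p k) ->
    exists a : R[i] -> R, {within M `&` ~` O', continuous a} /\
      forall z, (M `&` ~` O') z -> dir (p k) z / dir (q k) z = cis (a z).
  move=> oO' qp; have [|a ca aE] := has_arg_dir_component (K := M `&` ~` O') oO' _ qp.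
    by apply/seteqP; split=> // z [? []].
  by exists a.
have [al alP] := choice (fun k => argE O1 k oO1 (h1 k)).
have [be beP] := choice (fun k => argE O2 k oO2 (h2 k)).
pose X := M `&` ~` O1 `&` ~` O2.
have clX : closed X.
  by apply: closedI; [apply: closedI => //; exact: open_closedC | exact: open_closedC].
have X1 : X `<=` M `&` ~` O1 by move=> z [].
have X2 : X `<=` M `&` ~` O2 by move=> z [[]].
(* The closure of [U] lies in the open disc, so the bounding circle misses both [O1] and [O2]; it
   supplies the base point [z0]. *)
have circX : circle x0 rho `<=` X.
  move=> z zc; have nU : ~ U z.
    by move=> Uz; have := Udisk (subset_closure Uz); rewrite /odisk /= zc ltxx.
  by split; [split; [rewrite /M /cdisk /= zc|] |] => // -[].
pose z0 := x0 + rho%:C * cis 0.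
have cz0 : circle x0 rho z0 by exact: sqdist_cis.
have Xz0 : X z0 := circX _ cz0.
pose de k z := al k z - be k z.
have de1 k z : X z -> cis (de k z) = 1.
  move=> Xz; rewrite cisD cisN -(alP k).2; last exact: X1.
  rewrite -(beP k).2; last exact: X2.
  rewrite divff// mulf_neq0 ?invr_eq0// dir_neq0//; apply/eqP => zp.
    by case: Xz => _; apply; rewrite zp; case: (hpq k) => /OE[].
  by case: Xz => _; apply; rewrite zp; case: (hpq k) => _ /OE[].
(* A representative outside [X] is replaced by [z0], which makes its condition trivial. *)
pose e j := if `[< X (ts j) >] then ts j else z0.
have Xe j : X (e j) by rewrite /e; case: asboolP.
have dint k j : exists m : int, de k (e j) - de k z0 = pi *+ 2 * m%:~R.
  by apply: cis_eq1; rewrite cisD cisN !de1// invr1 mulr1.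
pose d k j := projT1 (cid (dint k j)).
have dP k j : de k (e j) - de k z0 = pi *+ 2 * (d k j)%:~R by rewrite /d; case: cid.
have [n [k0 nk0] nd] := int_kernel d.
pose w z := \sum_k (n k)%:~R * de k z.
have we j : w (e j) = w z0.
  apply/eqP; rewrite -subr_eq0 -sumrB.
  rewrite (eq_bigr (fun k => pi *+ 2 * (n k * d k j)%:~R)).
    by rewrite -mulr_sumr -rmorph_sum nd mulr0.
  by move=> k _; rewrite -mulrBr dP intrM mulrCA.
have w1 z : X z -> cis (w z) = 1.
  move=> Xz; rewrite cis_sum big1// => k _.
  by rewrite mulrC mulrzr cisMz de1// exp1rz.
have scale A (f : R[i] -> R) (m : int) : {within A, continuous f} ->
    {within A, continuous (fun z => m%:~R * f z)}.
  move=> cf; apply/subspace_continuousP => z Az.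
  have fz := (subspace_continuousP _ _).1 cf z Az.
  exact: (cvgM (@cvg_cst _ (m%:~R : R) _ (within A (nbhs z)) _) fz).
have cw : {within X, continuous w}.
  apply: within_continuous_sum => k; apply: scale.
  move=> z; apply: cvgB.
    exact: (continuous_subspaceW X1 (alP k).1).
  exact: (continuous_subspaceW X2 (beP k).1).
have w1' z : X z -> cis (w z) = cis (w z0) by move=> Xz; rewrite !w1.
have wcirc z : circle x0 rho z -> w z = w z0.
  apply: constant_of_cis_constant => //.
  - by move/continuous_closedP: (@continuous_sqdist R x0) => /(_ _ (@closed_eq _ (rho ^+ 2))).
  - exact: circle_connected.
  - exact: continuous_subspaceW circX cw.
  - by move=> y /circX; exact: w1'.
(* Otherwise the set [E] where [w] differs from [w z0] is compact, clopen in [X] and off the circle.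
   It then contains a component over an opposite sector, hence some [ts j], against [we]. *)
have wX z : X z -> w z = w z0.
  move=> Xz; apply: contrapT => wz.
  pose E := X `&` [set z | w z <> w z0].
  have clE : closed E by exact: level_set_complement_closed.
  have clE' := @level_set_closed X w (w z0) clX cw.
  have EM : E `<=` M by move=> y [[[]]].
  have [||||| dd [y [Uy sy yE]]] := hole_contains_sector cg og oU UOm UD rr (E := E).
  - exact: subclosed_compact clE cM EM.
  - exact: subset_trans EM diskOm.
  - by exists z.
  - by apply/seteqP; split=> // y [[[[_ n1] n2] _] [Uy [y1|y2]]]; [apply: n1 | apply: n2].
  - move=> y Ey; have oy : odisk x0 rho y.
      rewrite /odisk /= lt_neqAle; apply/andP; split; last exact: (EM y Ey).
      by apply/eqP => /wcirc; case: Ey.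
    have ny : (~` (X `&` [set z | w z = w z0])) y by move=> [_]; case: Ey.
    apply: filterS2 (open_nbhs_nbhs (conj (@odisk_open R x0 rho) oy))
      (open_nbhs_nbhs (conj (closed_openC clE') ny)) => v ov nv.
    have [O1v|nO1] := pselect (O1 v).
      by right; case: O1v => Uv ?; split=> //; left.
    have [O2v|nO2] := pselect (O2 v).
      by right; case: O2v => Uv ?; split=> //; right.
    have Xv : X v by split=> //; split=> //; exact: oM.
    by left; split=> // wv; apply: nv.
  have [j /yE Etj] := hts dd y Uy sy.
  have := we j; rewrite /e asboolT; last by case: Etj.
  by case: Etj.
(* Off [O] one of the two arguments is always available. On [X], where both are, the sums differ by
   the constant [w z0], so they glue. *)
pose a z := if `[< O1 z >] then \sum_k (n k)%:~R * be k z + w z0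
            else \sum_k (n k)%:~R * al k z.
have a1 z : (M `&` ~` O1) z -> a z = \sum_k (n k)%:~R * al k z.
  by move=> [_ nO1]; rewrite /a asboolF.
have a2 z : (M `&` ~` O2) z -> a z = \sum_k (n k)%:~R * be k z + w z0.
  move=> [Mz nO2]; rewrite /a; case: asboolP => // nO1.
  rewrite -(wX z)// -big_split /=; apply: eq_bigr => k _.
  by rewrite -mulrDr /de addrC subrK.
pose K := M `&` ~` O.
have KE : K = (M `&` ~` O1) `|` (M `&` ~` O2).
  apply/seteqP; split=> z; last by move=> [] [Mz nO]; split=> // /OE[].
  move=> [Mz nO]; have [O1z|?] := pselect (O1 z); last by left.
  by right; split=> // O2z; apply: nO; apply/OE.
have ca : {within K, continuous a}.
  rewrite KE; apply: withinU_continuous.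
  - by apply: closedI => //; exact: open_closedC.
  - by apply: closedI => //; exact: open_closedC.
  - apply: (subspace_eq_continuous (f := fun z => \sum_k (n k)%:~R * al k z)).
      by move=> z; rewrite inE => Az; exact/esym/a1.
    by apply: within_continuous_sum => k; apply: scale; exact: (alP k).1.
  - apply: (subspace_eq_continuous (f := fun z => \sum_k (n k)%:~R * be k z + w z0)).
      by move=> z; rewrite inE => Az; exact/esym/a2.
    have cb : {within M `&` ~` O2, continuous (fun z => \sum_k (n k)%:~R * be k z)}.
      by apply: within_continuous_sum => k; apply: scale; exact: (beP k).1.
    by move=> z; apply: cvgD; [exact: cb | exact: cvg_cst].
have aE z : K z -> \prod_k (dir (p k) z / dir (q k) z) ^ n k = cis (a z).
  rewrite KE => -[Kz|Kz].
    rewrite a1// cis_sum; apply: eq_bigr => k _.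
    by rewrite (alP k).2// mulrC mulrzr cisMz.
  rewrite a2// cisD w1// mulr1 cis_sum; apply: eq_bigr => k _.
  by rewrite (beP k).2// mulrC mulrzr cisMz.
pose V := connected_component O (p k0).
have Op k : O (p k) by case: (hpq k).
have Oq k : O (q k) by case: (hpq k).
have VO : V `<=` O by exact: connected_component_sub.
have Vp k : k != k0 -> ~ V (p k) by move=> kk /hpp kk'; rewrite kk' eqxx in kk.
have Vq k : ~ V (q k) by exact: hpq'.
(* All of the product except [dir (p k0) z ^ n k0]. Every [q k], and every [p k] with [k != k0],
   lies in [O] but not in [V], so [H] is continuous and unimodular on [V] and [K]. *)
pose H z := \prod_(k | k != k0) (dir (p k) z / dir (q k) z) ^ n k * (dir (q k0) z)^-1 ^ n k0.
have VKq z k : (V `|` K) z -> z != q k.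
  by move=> VKz; apply/eqP => zq; rewrite zq in VKz; case: VKz => [/Vq//|[_]]; apply.
have VKp z k : k != k0 -> (V `|` K) z -> z != p k.
  by move=> kk VKz; apply/eqP => zq; rewrite zq in VKz; case: VKz => [/(Vp _ kk)//|[_]]; apply.
move/eqP: nk0; apply.
apply: (dir_exp_boundary (K := K) (V := V) (M := M) (p := p k0) (H := H) (a := a)) => //.
- apply: subclosed_compact _ cM _; last by move=> z [].
  by apply: closedI => //; exact: open_closedC.
- exact: component_open.
- by apply/seteqP; split=> // z [/VO Oz [_]]; apply.
- move=> z clz; have [Oz|Oz] := pselect (O z).
    by left; exact: component_closed_in.
  right; split=> //; apply: clM; apply: closureS clz => y /VO[/UM].
  exact.
- by move=> z /VO[/UM].
- exact: connected_component_refl.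
- move=> z VKz; split.
    have ck k : {for z, continuous (fun v => (dir (q k) v)^-1)}.
      have zq := VKq z k VKz.
      exact: (cvgV (dir_neq0 zq) (continuous_dir zq)).
    have hq k : (dir (q k) z)^-1 != 0 by rewrite invr_eq0 dir_neq0// VKq.
    have cP : {for z, continuous (fun v => \prod_(k | k != k0) (dir (p k) v / dir (q k) v) ^ n k)}.
      apply: continuous_prod => k kk; apply: continuous_exprz.
        by rewrite mulf_neq0// dir_neq0// VKp.
      have cp : {for z, continuous (dir (p k))} by apply: continuous_dir; exact: VKp.
      exact: (cvgM cp (ck k)).
    have cQ : {for z, continuous (fun v => (dir (q k0) v)^-1 ^ n k0)}.
      by apply: continuous_exprz; [exact: hq | exact: ck].
    exact: (cvgM cP cQ).
  rewrite normrM norm_exprz1 ?normfV ?norm_dir ?invr1 ?VKq// mulr1 normr_prod.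
  apply: big1 => k kk; rewrite norm_exprz1// normrM normfV !norm_dir ?invr1 ?mulr1//.
    exact: VKq.
  exact: VKp.
move=> z Kz; rewrite -aE// (bigD1 k0)//= /H [in RHS]expfzMl -!mulrA; congr (_ * _); exact: mulrC.
Qed.

End pairs.

Lemma pigeonhole (S T : eqType) (s : seq S) (l : seq T) (f : S -> T) :
  uniq s -> {in s, forall x, f x \in l} -> (size l < size s)%N ->
  exists x y, [/\ x \in s, y \in s, x != y & f x = f y].
Proof.
move=> us fl ls; apply: contrapT => nex.
have fi : {in s &, injective f}.
  move=> x y xs ys fxy; apply/eqP; apply: contrapT => /negP xy.
  by apply: nex; exists x, y.
have : uniq (map f s) by rewrite map_inj_in_uniq.
move=> um; have h : {subset map f s <= l} by move=> _ /mapP[x xs ->]; exact: fl.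
by have := uniq_leq_size um h; rewrite size_map leqNgt ls.
Qed.

(** * Bounded fibers and isolated points *)

Section isolation.
Context {R : realType}.
Implicit Types (z w p q y : R[i]) (K O V S A : set R[i]) (r : R).

Lemma common_radius (T : eqType) (s : seq T) (P : R -> T -> Prop) b : 0 < b ->
    (forall r r' x, 0 < r' <= r -> P r x -> P r' x) ->
    {in s, forall x, exists2 r, 0 < r & P r x} ->
  exists2 r, 0 < r <= b & {in s, forall x, P r x}.
Proof.
move=> b0 mono; elim: s => [_|x s IH sP]; first by exists b => //; rewrite b0 lexx.
have [|r /andP[r0 rb] rP] := IH; first by move=> y ys; apply: sP; rewrite inE ys orbT.
have [|r' r'0 rx] := sP x; first by rewrite inE eqxx.
have m0 : 0 < Num.min r r' by rewrite lt_min r0.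
exists (Num.min r r'); first by rewrite m0 ge_min rb.
move=> y; rewrite inE => /orP[/eqP ->|ys].
  by apply: mono rx; rewrite m0 ge_min lexx orbT.
by apply: mono (rP y ys); rewrite m0 ge_min lexx.
Qed.

Variables (g : R[i] -> R[i]) (Om : set R[i]).
Hypotheses (oOm : open Om) (cg : forall z, Om z -> {for z, continuous g})
  (og : forall W, open W -> W `<=` Om -> open (g @` W))
  (td : totally_disconnected (Om `&` [set z | g z = 0])).

Lemma l1_le0 y : (l1 y <= 0) = (y == 0).
Proof.
rewrite eq_complex /= -[Re y == 0]normr_eq0 -[Im y == 0]normr_eq0 /l1.
have := normr_ge0 (Re y); have := normr_ge0 (Im y).
move: `|Re y| `|Im y| => a b a0 b0; apply/idP/andP => [h|[/eqP -> /eqP ->]].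
  by split; apply/eqP; lra.
by rewrite addr0.
Qed.

Lemma fiber_component_avoids p rho x W : 0 < rho -> cdisk p rho `<=` Om ->
  cdisk p rho x -> g x = 0 -> closed W -> ~ W x ->
  exists2 r, 0 < r & forall y,
    connected_component (cdisk p rho `&` [set z | l1 (g z) <= r]) x y -> ~ W y.
Proof.
move=> rho0 dOm dx gx clW Wx.
have ch : {within cdisk p rho, continuous (fun z => l1 (g z))}.
  apply: continuous_in_subspaceT => z; rewrite inE => /dOm Oz.
  exact: (cvg_comp _ _ (cg Oz) (@continuous_l1 R (g z))).
have td' : totally_disconnected (cdisk p rho `&` [set z | l1 (g z) <= 0]).
  move=> z dz; apply/seteqP; split=> [y zy|_ ->]; last exact: connected_component_refl.
  have sub : cdisk p rho `&` [set z | l1 (g z) <= 0] `<=` Om `&` [set z | g z = 0].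
    by move=> v [/dOm Ov] /=; rewrite l1_le0 => /eqP.
  by rewrite -(td (sub _ dz)); exact: component_mono sub _.
have hx : l1 (g x) <= 0 by rewrite l1_le0 gx.
have [r r0 rW] := component_shrink (@complex_hausdorff R) complex_normal (cdisk_compact rho0)
  ch td' dx hx clW Wx.
by exists r => // y xy Wy; move/seteqP: rW => [/(_ y)+ _]; apply.
Qed.

(** For small [r0] the component of [x0] in the part of the closed disc where [l1 (g z) <= r0]
    misses the circle. [U] is the component of [x0] in the open disc over the open diamond; its
    closure stays in that larger component, and components of an open set are relatively closed. *)
Lemma normal_neighborhood x0 : Om x0 -> g x0 = 0 ->
  exists rho r0 U, [/\ 0 < rho /\ cdisk x0 rho `<=` Om, 0 < r0, open U /\ U x0,
    closure U `<=` odisk x0 rho & forall z, closure U z -> diamond r0 (g z) -> U z].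
Proof.
move=> Ox0 gx0; have [rho rho0 dOm] := cdisk_nbhs (open_nbhs_nbhs (conj oOm Ox0)).
have sx0 : sqdist x0 x0 = 0 by rewrite /sqdist !subrr expr0n addr0.
have r20 : 0 < rho ^+ 2 by rewrite exprn_gt0.
have dx0 : odisk x0 rho x0 by rewrite /odisk /= sx0.
have clc : closed (circle x0 rho).
  by move/continuous_closedP: (@continuous_sqdist R x0) => /(_ _ (@closed_eq _ (rho ^+ 2))).
have [|r0 r00 rc] := fiber_component_avoids rho0 dOm (ltW dx0) gx0 clc.
  by rewrite /circle /= sx0 => h; rewrite -h ltxx in r20.
pose A := odisk x0 rho `&` g @^-1` diamond r0.
have oA : open A.
  rewrite openE => z [dz gz]; apply: filterI.
    exact: open_nbhs_nbhs (conj (@odisk_open R x0 rho) dz).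
  by apply: (cg (dOm _ (ltW dz))); exact: open_nbhs_nbhs (conj (@open_diamond R r0) gz).
have Ax0 : A x0 by split=> //; rewrite /= /diamond /= gx0 /l1 normr0 addr0.
pose U := connected_component A x0.
have Ux0 : U x0 by exact: connected_component_refl.
pose B := cdisk x0 rho `&` [set z | l1 (g z) <= r0].
have clB : closed B.
  apply: (closed_within_preimage _ _ (@closed_le _ r0)).
    exact: compact_closed (@complex_hausdorff R) (cdisk_compact rho0).
  apply: continuous_in_subspaceT => z; rewrite inE => /dOm Oz.
  exact: (cvg_comp _ _ (cg Oz) (@continuous_l1 R (g z))).
have UB : closure U `<=` connected_component B x0.
  apply: connected_component_max; first exact: subset_closure.
    move=> z clz; apply: clB; apply: closureS clz => v /connected_component_sub[dv gv].
    by split; exact: ltW.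
  by apply: connected_closure; exact: component_connected.
have Ud : closure U `<=` odisk x0 rho.
  move=> z /UB zB; rewrite /odisk /= lt_neqAle; apply/andP; split.
    by apply/eqP => /(rc z zB).
  by have [] := connected_component_sub zB.
exists rho, r0, U; split=> //; first by split=> //; exact: component_open.
move=> z clz gz; apply: component_closed_in => //; split=> //.
exact: Ud.
Qed.

Lemma fiber_bounded rho r0 U x0 : 0 < rho -> cdisk x0 rho `<=` Om -> 0 < r0 -> open U ->
    closure U `<=` odisk x0 rho -> (forall z, closure U z -> diamond r0 (g z) -> U z) ->
  exists L : nat, forall s : seq R[i], uniq s -> {in s, forall z, U z /\ g z = 0} ->
    (size s < L)%N.
Proof.
move=> rho0 dOm r00 oU Ud UD.
have od : odisk x0 rho `<=` cdisk x0 rho by move=> z /ltW.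
have Ucl := @subset_closure _ U.
have Ud' : U `<=` cdisk x0 rho := subset_trans Ucl (subset_trans Ud od).
have UOm : closure U `<=` Om := subset_trans (subset_trans Ud od) dOm.
have cU : compact (closure U).
  apply: subclosed_compact (cdisk_compact rho0) (subset_trans Ud od).
  exact: closed_closure.
have i1 : is_sign (1 : R) by left.
have im1 : is_sign (-1 : R) by right.
have r02 : 0 < r0 / 2 by rewrite divr_gt0.
have r02' : 0 <= r0 / 2 < r0 by rewrite ltW//=; lra.
(* The inner radius [r0 / 2] is fixed here, before [r] and the points [s], so that the
   representatives and the bound [L] depend on neither. *)
have reps s t : is_sign s -> is_sign t -> exists l : seq R[i], forall S z,
    open S -> connected S -> S `<=` diamond r0 -> sector s t (r0 / 2) r0 `<=` S ->
    U z -> S (g z) ->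
    exists2 y, y \in l & connected_component (U `&` g @^-1` S) z y.
  move=> hs ht.
  exact: (component_representatives cg og oU cU UOm UD (@open_sector _ _ _ _ _)
    (@sector_diamond _ _ _ _ _) (sector_point hs ht r02')).
have [rep1 rep1P] := reps 1 1 i1 i1; have [rep3 rep3P] := reps (-1) (-1) im1 im1.
have [rep2 rep2P] := reps 1 (-1) i1 im1; have [rep4 rep4P] := reps (-1) 1 im1 i1.
(* [B] is one more than the number of pairs of petal representatives, so among any [B] fiber points
   two share both petal components; [c + 1] blocks of [B] points give the required pairs. *)
pose ts := rep2 ++ rep4; pose c := size ts; pose B := (size rep1 * size rep3).+1.
exists (c.+1 * B)%N => s us sU; rewrite ltnNge; apply/negP => sL.
(* One [r] separates all points of the finite list over the small diamond; [r <= r0 / 2] keeps the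
   representatives valid. *)
have [||r /andP[rp rr] rP] := @common_radius _ [seq (x, y) | x <- s, y <- s]
  (fun r u => u.1 != u.2 -> ~ connected_component (U `&` g @^-1` diamond r) u.1 u.2) _ r02.
- move=> r r' [x y] /andP[_ rr'] /= h xy; apply: contra_not (h xy).
  by apply: component_mono => z [Uz gz]; split=> //; exact: lt_le_trans rr'.
- move=> [x y] /allpairsP[[x' y'] /= [xs ys [-> ->]]].
  have [->|xy] := eqVneq x' y'; first by exists 1.
  have [Ux gx] := sU x' xs.
  have [||r rp rP] := fiber_component_avoids (W := [set y']) rho0 dOm (Ud' _ Ux) gx.
  + by apply: compact_closed; [exact: complex_hausdorff | exact: compact_set1].
  + by move/eqP: xy.
  exists r => // _ h; apply: (rP y') => //.
  by apply: component_mono h => z [/Ud' dz gz]; split=> //; exact: ltW.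
have sep x y : x \in s -> y \in s ->
    connected_component (U `&` g @^-1` diamond r) x y -> x = y.
  move=> xs ys xy; apply/eqP; apply: contrapT => /negP h.
  by apply: (rP (x, y)) xy => //; apply/allpairsP; exists (x, y).
have rr0 : r <= r0 by lra.
have rlt : 0 < r < r0 by rewrite rp; lra.
have rle : 0 < r <= r0 by rewrite rp.
have col x : exists t : R[i] * R[i], x \in s -> [/\ t \in [seq (u, v) | u <- rep1, v <- rep3],
    connected_component (U `&` g @^-1` petal 1 1 r r0) x t.1 &
    connected_component (U `&` g @^-1` petal (-1) (-1) r r0) x t.2].
  have [xs|xs] := boolP (x \in s); last by exists (x, x).
  have [Ux gx] := sU x xs.
  have Pg a b : petal a b r r0 (g x) by right; rewrite /diamond /= gx /l1 normr0 addr0.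
  have [|||t t1 xt] := rep1P (petal 1 1 r r0) x (@open_petal _ _ _ _ _) _ _ _ Ux (Pg _ _).
  - exact: petal_connected.
  - exact: petal_diamond.
  - by apply: subset_trans (sector_mono rr) _; exact: sector_petal.
  have [|||t' t3 xt'] := rep3P (petal (-1) (-1) r r0) x (@open_petal _ _ _ _ _) _ _ _ Ux (Pg _ _).
  - exact: petal_connected.
  - exact: petal_diamond.
  - by apply: subset_trans (sector_mono rr) _; exact: sector_petal.
  by exists (t, t') => _; split=> //; apply/allpairsP; exists (t, t').
have [f fP] := choice col.
pose x m := nth 0 s m.
(* Block [k] consists of the indices from [k B] to [(k + 1) B - 1]; recovering [k] as the quotient
   by [B] shows that different blocks give different points. *)
have xs m (k : 'I_c.+1) : m \in iota (k * B) B -> x m \in s /\ (m < size s)%N /\ (m %/ B)%N = k.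
  rewrite mem_iota => /andP[m1 m2].
  have ms : (m < size s)%N.
    apply: leq_trans sL; apply: leq_trans m2 _.
    by rewrite -mulSnr leq_mul2r ltn_ord orbT.
  split; first exact: mem_nth.
  split=> //; rewrite -(subnKC m1) divnMDl// divn_small ?addn0//.
  by rewrite ltn_subLR.
have pq (k : 'I_c.+1) : exists u : nat * nat, [/\ u.1 \in iota (k * B) B,
    u.2 \in iota (k * B) B, u.1 != u.2 & f (x u.1) = f (x u.2)].
  have [|||i [j [iB jB ij fij]]] := @pigeonhole _ _ (iota (k * B) B)
      [seq (u, v) | u <- rep1, v <- rep3] (fun m => f (x m)).
  - exact: iota_uniq.
  - by move=> m /xs[/fP[]].
  - by rewrite size_allpairs size_iota.
  by exists (i, j).
have [u uP] := choice pq.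
have xinj i j : (i < size s)%N -> (j < size s)%N -> x i = x j -> i = j.
  by move=> si sj /eqP; rewrite nth_uniq// => /eqP.
have ui k : x (u k).1 \in s /\ ((u k).1 < size s)%N /\ ((u k).1 %/ B)%N = k.
  by case: (uP k) => /xs.
have uj k : x (u k).2 \in s /\ ((u k).2 < size s)%N /\ ((u k).2 %/ B)%N = k.
  by case: (uP k) => _ /xs.
have over_diamond y : y \in s -> (U `&` g @^-1` diamond r) y.
  by move=> /sU[Uy gy]; split=> //; rewrite /diamond /= gy /l1 normr0 addr0.
apply: (no_many_pairs cg og rho0 dOm oU Ud UD rle (ts := fun j : 'I_c => nth 0 ts j)
  (p := fun k => x (u k).1) (q := fun k => x (u k).2)).
- move=> d z Uz gz.
  suff [t tts zt] : exists2 t, t \in ts &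
      connected_component (U `&` g @^-1` opposite_sector r0 d r) z t.
    have ti : (index t ts < c)%N by rewrite index_mem.
    by exists (Ordinal ti); rewrite /= nth_index.
  have cs : connected (opposite_sector r0 d r).
    by apply: sector_connected; case: (d); rewrite ?expr0 ?expr1 ?opprK.
  have os : open (opposite_sector r0 d r) by exact: open_sector.
  have ds : opposite_sector r0 d r `<=` diamond r0 by exact: sector_diamond.
  case: d gz cs os ds => gz cs os ds.
    have [|t t4 zt] := rep4P _ z os cs ds _ Uz gz.
      by rewrite /opposite_sector expr1 opprK; exact: sector_mono.
    by exists t => //; rewrite mem_cat t4 orbT.
  have [|t t2 zt] := rep2P _ z os cs ds _ Uz gz.
    by rewrite /opposite_sector expr0; exact: sector_mono.
  by exists t => //; rewrite mem_cat t2.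
- by move=> k; split; apply: over_diamond; [case: (ui k) | case: (uj k)].
- move=> k; case: (fP _ (ui k).1) => _ h1 _; case: (fP _ (uj k).1) => _ h2 _.
  case: (uP k) => _ _ _ e; rewrite -e in h2.
  exact: connected_component_trans h2 (connected_component_sym h1).
- move=> k; case: (fP _ (ui k).1) => _ _ h1; case: (fP _ (uj k).1) => _ _ h2.
  case: (uP k) => _ _ _ e; rewrite -e in h2.
  exact: connected_component_trans h2 (connected_component_sym h1).
- move=> k k' /(sep _ _ (ui k).1 (ui k').1)/(xinj _ _ (ui k).2.1 (ui k').2.1) e.
  by apply: val_inj; rewrite /= -(ui k).2.2 -(ui k').2.2 e.
move=> k k' /(sep _ _ (ui k).1 (uj k').1)/(xinj _ _ (ui k).2.1 (uj k').2.1) e.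
have kk : k = k' by apply: val_inj; rewrite /= -(ui k).2.2 -(uj k').2.2 e.
by case: (uP k) => _ _ /eqP + _; apply; rewrite e kk.
Qed.

(** If [x0] is not isolated, new fiber points of [U] can be picked one at a time, since removing the
    finitely many already chosen leaves a neighbourhood of [x0]; after [L] picks the bound fails. *)
Lemma fiber_isolated x0 : Om x0 -> g x0 = 0 ->
  exists2 V, nbhs x0 V & forall z, V z -> Om z /\ (g z = 0 -> z = x0).
Proof.
move=> Ox0 gx0.
have [rho [r0 [U [[rho0 dOm] r00 [oU Ux0] Ud UD]]]] := normal_neighborhood Ox0 gx0.
have [L LP] := fiber_bounded rho0 dOm r00 oU Ud UD.
have UOm z : U z -> Om z.
  by move=> Uz; apply: dOm; apply/ltW/Ud; exact: subset_closure.
apply: contrapT => nV.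
suff [s us [ss sU]] : exists2 s : seq R[i], uniq s &
    size s = L /\ {in s, forall z, [/\ U z, g z = 0 & z != x0]}.
  by have := LP s us (fun z zs => let: And3 a b _ := sU z zs in conj a b); rewrite ss ltnn.
elim: L {LP} => [|n [s us [ss sU]]]; first by exists [::].
have oV : open (U `&` ~` [set` s]).
  apply: openI => //; apply: closed_openC; apply: compact_closed.
    exact: complex_hausdorff.
  by apply: finite_compact; exact: finite_seq.
have Vx0 : (U `&` ~` [set` s]) x0.
  by split=> // /sU[_ _]; rewrite eqxx.
apply: contrapT => nex; apply: nV; exists (U `&` ~` [set` s]).
  exact: open_nbhs_nbhs.
move=> z [Uz zs]; split; first exact: UOm.
move=> gz; apply/eqP; apply: contrapT => /negP zx0; apply: nex.
exists (z :: s); first by rewrite /= us andbT; apply/negP.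
split; first by rewrite /= ss.
by move=> y; rewrite inE => /orP[/eqP ->|/sU].
Qed.

End isolation.

(** * Subspaces *)

Section subtype.
Context {T : topologicalType} (D : set T).

Lemma nbhs_subtype (a : D) (A : set D) : nbhs a A ->
  exists2 W : set T, nbhs (set_val a) W & forall b : D, W (set_val b) -> A b.
Proof.
move=> aA; have [B [[W oW WB] Ba] BA] : exists2 B, open_nbhs a B & B `<=` A.
  by move: aA; rewrite nbhsE.
have Wa : W (set_val a) by rewrite -[W _]/((set_val @^-1` W) a) WB.
exists W; first exact: (open_nbhs_nbhs (conj oW Wa)).
by move=> b Wb; apply: BA; rewrite -WB.
Qed.

Lemma nbhs_preimage_val (a : D) (W : set T) : nbhs (set_val a) W ->
  nbhs a (set_val @^-1` W).
Proof. by move=> /(@initial_continuous D T set_val a). Qed.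

(** A total inverse of the inclusion with default value [a] off [D]; it turns a map on the subtype
    into one on all of [T]. *)
Definition retract_subtype (a : D) (z : T) : D :=
  if pselect (D z) is left Dz then exist _ z (mem_set Dz) else a.

Lemma retract_subtypeE a z : D z -> set_val (retract_subtype a z) = z.
Proof. by rewrite /retract_subtype; case: pselect. Qed.

Lemma retract_subtypeK a (b : D) : retract_subtype a (set_val b) = b.
Proof. by apply: val_inj; rewrite -[LHS]/(set_val _) retract_subtypeE//; exact: set_valP. Qed.

Lemma continuous_retract_subtype a A : A `<=` D -> {within A, continuous (retract_subtype a)}.
Proof.
move=> AD; apply/subspace_continuousP => z Az P /nbhs_subtype[W Wz WP].
rewrite retract_subtypeE in Wz; last exact: AD.
have : nbhs z (fun w => A w -> P (retract_subtype a w)).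
  by apply: filterS Wz => w Ww Aw; apply: WP; rewrite retract_subtypeE//; exact: AD.
exact.
Qed.

End subtype.

Unset Implicit Arguments.
Set Strict Implicit.
Local Close Scope ring_scope.

(* The domain of f is the subtype Omega with its subspace topology *)
Theorem theorem1p1 (R : realType) (Omega : set R[i]) (f : Omega -> R[i])
  (domOmega : domain Omega)
  (cf : continuous f) (openf : open_map f) (lightf : light_map f) :
  discrete_map f.
Proof.
case: domOmega => _ oOm _ y a fa.
(* Translation by [y] moves the fiber over 0; the values off [Omega] are mere defaults. *)
pose g (z : R[i]) : R[i] := (f (retract_subtype a z) - y)%R.
have gE (b : Omega) : g (set_val b) = (f b - y)%R by rewrite /g retract_subtypeK.
have cg z : Omega z -> {for z, continuous g}.
  move=> Oz; set b : Omega := retract_subtype a z.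
  have bz : set_val b = z by exact: retract_subtypeE.
  have h : f (retract_subtype a w) @[w --> z] --> f b.
    move=> P /cf /nbhs_subtype[W]; rewrite bz => Wz WP.
    have : nbhs z (fun w => P (f (retract_subtype a w))).
      apply: filterS2 (open_nbhs_nbhs (conj oOm Oz)) Wz => w Ow Ww.
      by apply: WP; rewrite retract_subtypeE.
    exact.
  exact: (cvgB h (@cvg_cst _ y _ (nbhs z) _)).
have og W : open W -> W `<=` Omega -> open (g @` W).
  move=> oW WO; have oV : open (f @` (set_val @^-1` W)) by apply: openf; exists W.
  have ca : continuous (fun v : R[i] => v + y)%R.
    move=> v; have cv : v' @[v' --> v] --> v by move=> P.
    exact: (cvgD cv (@cvg_cst _ y _ (nbhs v) _)).
  have -> : g @` W = (fun v => v + y)%R @^-1` (f @` (set_val @^-1` W)).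
    apply/seteqP; split=> [_ [z Wz <-]|v [b Wb /= bv]].
      exists (retract_subtype a z); last by rewrite /g subrK.
      by rewrite /= retract_subtypeE//; exact: WO.
    by exists (set_val b) => //; rewrite gE bv addrK.
  by move/continuousP: ca => /(_ _ oV).
(* A connected subset of this fiber in the plane is carried by the retraction to a connected subset
   of the fiber of [f] in the subtype, where lightness applies. *)
have td : totally_disconnected (Omega `&` [set z | g z = 0%R]).
  move=> x [Ox gx]; apply/seteqP; split=> [z [C [Cx CO cC] Cz]|_ ->]; last first.
    exact: connected_component_refl.
  have CO' : C `<=` Omega by move=> w /CO[].
  have cC' : connected (retract_subtype a @` C).
    exact: connected_continuous_connected cC (continuous_retract_subtype CO').
  have fx : f (retract_subtype a x) = y by apply/eqP; rewrite -subr_eq0; apply/eqP.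
  have : connected_component (f @^-1` [set y]) (retract_subtype a x) (retract_subtype a z).
    exists (retract_subtype a @` C); last by exists z.
    have rx : (retract_subtype a @` C) (retract_subtype a x) by exists x => //.
    split; [exact: rx | | exact: cC'].
    by move=> _ [w /CO[_ gw] <-]; apply/eqP; rewrite -subr_eq0; apply/eqP.
  rewrite lightf// => /(congr1 set_val); rewrite !retract_subtypeE//.
  exact: CO'.
have [|V Va VP] := fiber_isolated oOm cg og td (set_valP a).
  by rewrite gE (fa : f a = y) subrr.
split; first exact: mem_set.
exists (set_val @^-1` V); first exact: nbhs_preimage_val.
apply/seteqP; split=> [b [/VP[_ Vb] fb]|_ ->]; last by split=> //; exact: nbhs_singleton Va.
by apply: val_inj; apply: Vb; rewrite gE (fb : f b = y) subrr.
Qed.
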